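(* For every $\varepsilon>0$ there exists a Schauder basis $(z_j)_{j=1}^\infty$ of $L_2(\mathbb{R})$ such that every $z_j$ is a non-negative function and the basis constant of $(z_j)_{j=1}^\infty$ is at most $1+\varepsilon$.
   Context: A sequence $(x_j)$ in a Banach space $X$ is a Schauder basis if every $x\in X$ has a unique representation $x=\sum_{j=1}^\infty a_jx_j$ (norm convergence). Its basis constant is the least $C$ such that $\|\sum_{j=1}^m a_jx_j\|\le C\|\sum_{j=1}^n a_jx_j\|$ for all $m\le n$ and all scalars $(a_j)$. A function in $L_2(\mathbb{R})$ is non-negative if it is $\ge 0$ almost everywhere. *)

(* Defs.v *)
From HB Require Import structures.
From mathcomp Require Import all_boot all_order all_algebra.
From mathcomp Require Import all_classical all_reals all_analysis.
Set Implicit Arguments.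
Unset Strict Implicit.
Unset Printing Implicit Defensive.
Import Order.TTheory GRing.Theory Num.Theory.
Local Open Scope classical_set_scope.
Local Open Scope ring_scope.

(* Membership in L_2(R): measurable real functions with finite L_2 norm.
   Elements of L_2 are represented by functions; the L_2 "norm" below is a
   seminorm on functions, equal to the norm of the a.e.-class. *)
Definition L2 (R : realType) : {pred R -> R} :=
  Lfun (@lebesgue_measure R) 2%:E.

Definition L2norm (R : realType) (f : R -> R) : \bar R :=
  ('N[@lebesgue_measure R]_2%:E [EFin \o f])%E.

(* partial sum  sum_{j < n} a_j z_j  (0-indexed; corresponds to j = 1..n) *)
Definition psum (R : realType) (a : nat -> R) (z : nat -> R -> R) (n : nat)
  : R -> R := fun x => \sum_(j < n) a j * z j x.

Definition expands_to (R : realType) (z : nat -> R -> R) (a : nat -> R)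
  (f : R -> R) : Prop :=
  ((fun n => L2norm (fun x => f x - psum a z n x)) @ \oo --> 0%E)%classic.

Definition schauder_basis_L2 (R : realType) (z : nat -> R -> R) : Prop :=
  (forall j, z j \in @L2 R) /\
  (forall f, f \in @L2 R -> exists! a : nat -> R, expands_to z a f).

Definition basis_constant (R : realType) (z : nat -> R -> R) : \bar R :=
  ereal_inf [set C%:E | C in [set C : R | forall (m n : nat) (a : nat -> R),
      (m <= n)%N -> (L2norm (psum a z m) <= C%:E * L2norm (psum a z n))%E]].

Definition nonneg_fun (R : realType) (f : R -> R) : Prop :=
  {ae @lebesgue_measure R, forall x, 0 <= f x}.

(* Main.v *)
(** The span of non-negative functions already chosen is brought closer to a
    signed [f], orthogonal to it, by adding a block [z_j = y_j + max(0, s_j f)],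
    where the [y_j >= 0] live on a fresh region. In [sum_j b_j z_j] the function
    [f] has weight [(sum_j s_j b_j) / 2] and [|f|] has weight
    [(sum_j |s_j| b_j) / 2]. The weight of [f] measures how much the distance
    from [f] to the span decreases; only the weight of [|f|] costs anything in
    the angle between the block and the previous span. So one needs finite
    non-negative sequences [y_j] (gadgets) with basis constant close to 1 whose
    [f]-weight is [T <r, .>] with [T] fixed and [r] a unit vector of their span,
    while the [|f|]-weight is at most [tau |.|] with [tau] as small as desired:
    each block then multiplies the distance by [(1 + T^2/4)^(-1/2)] and the basis
    constant by [1 + O(tau)].

    Gadgets with small [tau / T] come from an amplification: in [m^2] disjoint
    copies of a gadget, couple every copy to minus the sum of the vectors [r] of
    all the copies in the way a gadget is coupled to [f]. The symmetric mode is
    not amplified, the signed one is multiplied by [1 / (1 - theta)], and a copy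
    interacts with the others by only [O(theta / m)], so that the basis constant
    stays below [(1 + 2 theta) / (1 - 2 theta)], up to a factor tending to 1,
    however often the step is iterated. *)
From HB Require Import structures.
Require Import Defs.
From mathcomp Require Import all_boot all_order all_algebra.
From mathcomp Require Import all_classical all_reals all_analysis.
From mathcomp Require Import measurable_realfun ring lra.
Set Implicit Arguments.
Unset Strict Implicit.
Unset Printing Implicit Defensive.
Import Order.TTheory GRing.Theory Num.Theory.
Import numFieldNormedType.Exports HBNNSimple.
Local Open Scope classical_set_scope.
Local Open Scope ring_scope.

(** * Semi-inner products *)

(** Positivity without definiteness: the elements of L_2 below are functions, not classes, so a
    nonzero vector may have norm zero. *)
Record semi_inner (R : realType) (V : lmodType R) := SemiInner {
  dot :> V -> V -> R;
  dotC : forall u v, dot u v = dot v u;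
  dotPl : forall a u v w, dot (a *: u + v) w = a * dot u w + dot v w;
  dot_ge0 : forall u, 0 <= dot u u }.

Section semi_inner_theory.
Context (R : realType) (V : lmodType R) (ip : semi_inner V).
Implicit Types (u v w : V) (a b : R).

Lemma dotDl u v w : ip (u + v) w = ip u w + ip v w.
Proof. by have := dotPl ip 1 u v w; rewrite scale1r mul1r. Qed.

Lemma dot0l w : ip 0 w = 0.
Proof. by apply: (addrI (ip 0 w)); rewrite -dotDl !addr0. Qed.

Lemma dotZl a u w : ip (a *: u) w = a * ip u w.
Proof. by have := dotPl ip a u 0 w; rewrite !addr0 dot0l addr0. Qed.

Lemma dotNl u w : ip (- u) w = - ip u w.
Proof. by rewrite -scaleN1r dotZl mulN1r. Qed.

Lemma dotDr u v w : ip w (u + v) = ip w u + ip w v.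
Proof. by rewrite !(dotC ip w) dotDl. Qed.

Lemma dot0r w : ip w 0 = 0.
Proof. by rewrite dotC dot0l. Qed.

Lemma dotZr a u w : ip w (a *: u) = a * ip w u.
Proof. by rewrite !(dotC ip w) dotZl. Qed.

Lemma dotNr u w : ip w (- u) = - ip w u.
Proof. by rewrite !(dotC ip w) dotNl. Qed.

Definition dotE := (dotDl, dotDr, dotZl, dotZr, dotNl, dotNr, dot0l, dot0r).

Lemma dot_suml (J : Type) (r : seq J) (P : pred J) (F : J -> V) w :
  ip (\sum_(j <- r | P j) F j) w = \sum_(j <- r | P j) ip (F j) w.
Proof.
by elim/big_rec2 : _ => [|j x y _ <-]; rewrite ?dot0l// dotDl.
Qed.

Lemma dot_sumr (J : Type) (r : seq J) (P : pred J) (F : J -> V) w :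
  ip w (\sum_(j <- r | P j) F j) = \sum_(j <- r | P j) ip w (F j).
Proof. by rewrite dotC dot_suml; apply: eq_bigr => j _; rewrite dotC. Qed.

Definition nsq v := ip v v.

Lemma nsq_ge0 v : 0 <= nsq v. Proof. exact: dot_ge0. Qed.

Lemma nsqD u v : nsq (u + v) = nsq u + 2 * ip u v + nsq v.
Proof. by rewrite /nsq !dotE (dotC ip v u); ring. Qed.

Lemma nsqZ a u : nsq (a *: u) = a ^+ 2 * nsq u.
Proof. by rewrite /nsq !dotE mulrA expr2. Qed.

Lemma cauchy_schwarz u v : ip u v ^+ 2 <= nsq u * nsq v.
Proof.
have h t : 0 <= nsq u + 2 * t * ip u v + t ^+ 2 * nsq v.
  by have := nsq_ge0 (u + t *: v); rewrite nsqD nsqZ dotZr mulrA.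
have := nsq_ge0 v; rewrite le_eqVlt => /predU1P[v0|v0].
  rewrite -v0 mulr0; have [->|uv0] := eqVneq (ip u v) 0; first by rewrite expr0n.
  (* When [nsq v = 0] the quadratic in [t] is affine; at this [t] it would equal -1. *)
  have := h (- (nsq u + 1) / (2 * ip u v)).
  rewrite -v0 mulr0 addr0.
  have -> : 2 * (- (nsq u + 1) / (2 * ip u v)) * ip u v = - (nsq u + 1) by field.
  lra.
have := h (- ip u v / nsq v).
have -> : nsq u + 2 * (- ip u v / nsq v) * ip u v + (- ip u v / nsq v) ^+ 2 * nsq v
  = (nsq u * nsq v - ip u v ^+ 2) / nsq v by field; rewrite gt_eqF.
by rewrite pmulr_lge0 ?invr_gt0// subr_ge0.
Qed.

(** Because 4pq <= (p + q)^2. It turns estimates between squares into linear ones. *)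
Lemma amgm (x c p q : R) : 0 <= c -> 0 <= p -> 0 <= q ->
  x ^+ 2 <= c ^+ 2 * (p * q) -> `|2 * x| <= c * (p + q).
Proof.
move=> c0 p0 q0 h.
rewrite -[leRHS]ger0_norm ?mulr_ge0 ?addr_ge0// -ler_sqr ?nnegrE//.
rewrite !real_normK ?num_real// !exprMn.
apply: (@le_trans _ _ (4 * (c ^+ 2 * (p * q)))); first by rewrite -natrX ler_pM2l.
have := sqr_ge0 (c * (p - q)); lra.
Qed.

Lemma dot_amgm (c : R) u v : 0 <= c -> ip u v ^+ 2 <= c ^+ 2 * (nsq u * nsq v) ->
  `|2 * ip u v| <= c * (nsq u + nsq v).
Proof. by move=> c0 h; apply: amgm => //; exact: nsq_ge0. Qed.

Lemma dot_amgm1 u v : `|2 * ip u v| <= nsq u + nsq v.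
Proof.
by rewrite -[leRHS]mul1r; apply: dot_amgm => //; rewrite expr1n mul1r cauchy_schwarz.
Qed.

Lemma nsq_sum M (y : 'I_M -> V) :
  nsq (\sum_q y q) <= M%:R * \sum_q nsq (y q).
Proof.
rewrite /nsq dot_suml.
have h q : ip (y q) (\sum_p y p) <= \sum_p (nsq (y q) + nsq (y p)) / 2.
  rewrite dot_sumr; apply: ler_sum => p _.
  by have := ler_normlW (dot_amgm1 (y q) (y p)); lra.
apply: (le_trans (ler_sum _ (fun q _ => h q))).
under eq_bigr => q _.
  under eq_bigr do rewrite mulrDl.
  rewrite big_split/= sumr_const card_ord.
over.
rewrite big_split/= sumr_const card_ord sumrMnl -mulrnDl -mulr_suml -splitr.
by rewrite mulr_natl.
Qed.

(** * Truncation under a small perturbation of the identity *)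

Section perturbed_truncation.
Variables (theta eta : R) (K : V -> V).
Hypotheses (theta0 : 0 <= theta) (theta1 : theta <= 1 / 2).
Hypotheses (eta0 : 0 <= eta) (eta1 : eta <= 1 / 10).
Hypothesis KD : {morph K : u v / u + v}.
Hypothesis Kle : forall u, nsq (K u) <= theta ^+ 2 * nsq u.

Let L u := u + K u.

Lemma perturbation_bounds u :
  (1 - theta) ^+ 2 * nsq u <= nsq (L u) <= (1 + theta) ^+ 2 * nsq u.
Proof.
have [t0 t1] := (theta0, theta1).
have uK : `|2 * ip u (K u)| <= 2 * theta * nsq u.
  have -> : 2 * theta * nsq u = theta * (nsq u + nsq u) by ring.
  apply: amgm => //; [exact: nsq_ge0|exact: nsq_ge0|].
  apply: (le_trans (cauchy_schwarz _ _)).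
  by have := ler_wpM2l (nsq_ge0 u) (Kle u); lra.
move: uK; rewrite ler_norml => /andP[uK1 uK2].
rewrite /L nsqD; have Ku := Kle u.
have k0 := nsq_ge0 (K u); have u0 := nsq_ge0 u.
apply/andP; split; last by nra.
(* The lower bound is [|u + K u| >= |u| - |K u|]. *)
have [k k00 kE] : exists2 k : R, 0 <= k & k ^+ 2 = nsq (K u).
  by exists (Num.sqrt (nsq (K u))); rewrite ?sqrtr_ge0 ?sqr_sqrtr.
have [n n00 nE] : exists2 n : R, 0 <= n & n ^+ 2 = nsq u.
  by exists (Num.sqrt (nsq u)); rewrite ?sqrtr_ge0 ?sqr_sqrtr.
have kn : k <= theta * n.
  by rewrite -ler_sqr ?nnegrE ?mulr_ge0// exprMn kE nE.
have ip1 : `|ip u (K u)| <= n * k.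
  rewrite -[leRHS]ger0_norm ?mulr_ge0// -ler_sqr ?nnegrE//.
  by rewrite !real_normK ?num_real// exprMn kE nE cauchy_schwarz.
move: ip1; rewrite ler_norml => /andP[ip1 _].
rewrite -kE -nE -exprMn.
have t2 : 0 <= 1 - theta by lra.
have tn : 0 <= (1 - theta) * n by exact: mulr_ge0.
have : ((1 - theta) * n) ^+ 2 <= (n - k) ^+ 2 by rewrite ler_sqr ?nnegrE; lra.
lra.
Qed.

(** In the application [h] lives in one copy of a gadget and [e] in the others; [K] couples all
    copies, and [eta] measures how weakly one copy interacts with the rest. *)
Definition almost_decoupled e h := [/\ ip e h = 0,
  nsq (K h) <= eta ^+ 2 * nsq h & ip (K e) h ^+ 2 <= eta ^+ 2 * (nsq e * nsq h)].

(** Expanding leaves the terms 2<Ke,h>, 2<Le,Kh>, 2<h,Kh> and |Kh|^2. The first is at most eta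
    (4|Le|^2 + |h|^2), since theta <= 1/2 gives |e|^2 <= 4|Le|^2; the four bounds add up to the
    factor 5. *)
Lemma almost_orthogonal e h : almost_decoupled e h ->
  `|nsq (L (e + h)) - (nsq (L e) + nsq h)| <= 5 * eta * (nsq (L e) + nsq h).
Proof.
case=> eh0 Kh Keh; have [[t0 t1] [e0 e1]] := (theta0, theta1, (eta0, eta1)).
have -> : L (e + h) = L e + (h + K h) by rewrite /L KD addrACA.
have LKh : ip (L e) h = ip (K e) h by rewrite /L dotDl eh0 add0r.
rewrite (nsqD (L e)) (nsqD h) dotDr LKh.
have h1 : `|2 * ip (K e) h| <= eta * (nsq e + nsq h).
  by apply: amgm => //; exact: nsq_ge0.
have h2 : `|2 * ip (L e) (K h)| <= eta * (nsq (L e) + nsq h).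
  apply: amgm => //; [exact: nsq_ge0|exact: nsq_ge0|].
  apply: (le_trans (cauchy_schwarz _ _)).
  by have := ler_wpM2l (nsq_ge0 (L e)) Kh; lra.
have h3 : `|2 * ip h (K h)| <= eta * (nsq h + nsq h).
  apply: amgm => //; [exact: nsq_ge0|exact: nsq_ge0|].
  apply: (le_trans (cauchy_schwarz _ _)).
  by have := ler_wpM2l (nsq_ge0 h) Kh; lra.
have /andP[h4 _] := perturbation_bounds e.
have := nsq_ge0 e; have := nsq_ge0 h; have := nsq_ge0 (K h).
move=> k0 h0 ne0.
have h5 : nsq e <= 4 * nsq (L e).
  have q4 : 1 / 4 <= (1 - theta) ^+ 2.
    by have := mulr_ge0 (_ : 0 <= 1 / 2 - theta) (_ : 0 <= 3 / 2 - theta); lra.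
  by have := ler_wpM2r ne0 q4; lra.
have h6 : nsq (K h) <= eta * nsq h.
  apply: (le_trans Kh); apply: ler_wpM2r => //.
  by rewrite expr2 ler_piMr//; lra.
have h7 := ler_wpM2l eta0 h5.
move: h1 h2 h3; rewrite !ler_norml => /andP[? ?] /andP[? ?] /andP[? ?].
by apply/andP; split; lra.
Qed.

(** The part [e] suffers only the distortion of [L], the part [h] only the factor [Q]. As the parts
    are almost orthogonal, the losses combine as a maximum and not as a product, which is what
    allows unlimited iteration. *)
Lemma perturbed_truncation Q e h e' h' :
  almost_decoupled e h -> almost_decoupled e' h' ->
  nsq e' <= nsq e -> nsq h' <= Q * nsq h ->
  ((1 + theta) / (1 - theta)) ^+ 2 <= Q ->
  nsq (L (e' + h')) <= Q * ((1 + 5 * eta) / (1 - 5 * eta)) * nsq (L (e + h)).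
Proof.
move=> eh eh' ee hh HQ.
have [[t0 t1] [e0 e1]] := (theta0, theta1, (eta0, eta1)).
have := almost_orthogonal eh; have := almost_orthogonal eh'.
rewrite !ler_norml => /andP[_ a1] /andP[a2 _].
have /andP[_ b1] := perturbation_bounds e'.
have /andP[b2 _] := perturbation_bounds e.
have Q0 : 0 <= Q by apply: le_trans HQ; exact: sqr_ge0.
have t2 : 0 < 1 - theta by lra.
have c1 : nsq (L e') <= Q * nsq (L e).
  apply: (le_trans b1); apply: le_trans (ler_wpM2r (nsq_ge0 _) HQ).
  rewrite /= expr_div_n -[leRHS]mulrA; apply: ler_wpM2l; first exact: sqr_ge0.
  rewrite ler_pdivlMl ?exprn_gt0//; apply: le_trans b2.
  by apply: ler_wpM2l => //; exact: sqr_ge0.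
have := nsq_ge0 (L e); have := nsq_ge0 h => h0 L0.
have e5 : 0 < 1 - 5 * eta by lra.
rewrite mulrA mulrAC ler_pdivlMr//.
set X := nsq (L (e' + h')) in a1 *; set Y := nsq (L (e + h)) in a2 *.
have X1 : X <= (1 + 5 * eta) * (Q * (nsq (L e) + nsq h)).
  apply: (@le_trans _ _ ((1 + 5 * eta) * (nsq (L e') + nsq h'))); first lra.
  by rewrite ler_wpM2l//; lra.
have Y1 : (1 - 5 * eta) * (nsq (L e) + nsq h) <= Y by lra.
apply: (le_trans (ler_wpM2r (ltW e5) X1)).
have := ler_wpM2l (_ : 0 <= (1 + 5 * eta) * Q) Y1.
rewrite mulr_ge0//; last by lra.
by move=> /(_ isT); lra.
Qed.

End perturbed_truncation.

End semi_inner_theory.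

(** * Gadgets *)

Definition mul_dot (R : realType) : semi_inner R^o.
Proof.
apply: (@SemiInner R R^o (fun x y : R => x * y)) => [u v|a u v w|u].
- by rewrite mulrC.
- by rewrite mulrDl mulrA.
- by rewrite -expr2 sqr_ge0.
Defined.

Definition pi_dot_subdef (R : realType) (J : finType) (V : lmodType R)
  (ip : semi_inner V) : semi_inner (J -> V).
Proof.
apply: (@SemiInner R (J -> V) (fun u v => \sum_j ip (u j) (v j))) => [u v|a u v w|u].
- by apply: eq_bigr => j _; rewrite dotC.
- by rewrite mulr_sumr -big_split/=; apply: eq_bigr => j _; rewrite !fctE dotPl.
- by apply: sumr_ge0 => j _; exact: nsq_ge0.
Defined.

HB.lock Definition pi_dot (R : realType) (J : finType) (V : lmodType R)
  (ip : semi_inner V) : semi_inner (J -> V) := pi_dot_subdef J ip.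

Lemma pi_dotE (R : realType) (J : finType) (V : lmodType R) (ip : semi_inner V)
  (u v : J -> V) : pi_dot J ip u v = \sum_j ip (u j) (v j).
Proof. by rewrite pi_dot.unlock. Qed.

Section combinations.
Context (R : realType) (V : lmodType R).
Implicit Types (b : nat -> R) (Y : nat -> V).

Definition comb n b Y : V := \sum_(j < n) b j *: Y j.

Lemma eq_comb n b b' Y : (forall j, (j < n)%N -> b j = b' j) ->
  comb n b Y = comb n b' Y.
Proof. by move=> bb; apply: eq_bigr => j _; rewrite bb. Qed.

Lemma comb0 n b Y : (forall j, (j < n)%N -> b j = 0) -> comb n b Y = 0.
Proof. by move=> b0; apply: big1 => j _; rewrite b0// scale0r. Qed.

Lemma combZ n a b Y : comb n (fun j => a * b j) Y = a *: comb n b Y.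
Proof. by rewrite /comb scaler_sumr; apply: eq_bigr => j _; rewrite scalerA. Qed.

Lemma combD n b b' Y : comb n (fun j => b j + b' j) Y = comb n b Y + comb n b' Y.
Proof. by rewrite /comb -big_split/=; apply: eq_bigr => j _; rewrite scalerDl. Qed.

(** A partial sum is a full sum with some coefficients set to zero, so identities for full
    combinations apply to it. *)
Lemma comb_trunc n m b Y : (m <= n)%N ->
  comb n (fun j => if (j < m)%N then b j else 0) Y = comb m b Y.
Proof.
move=> mn; rewrite /comb.
rewrite (big_ord_widen_cond n xpredT (fun j => b j *: Y j) mn) [RHS]big_mkcond/=.
by apply: eq_bigr => j _; case: ifP; rewrite // scale0r.
Qed.

Lemma comb_add n p b Y :
  comb (n + p) b Y =
  comb n b Y + comb p (fun j => b (n + j)%N) (fun j => Y (n + j)%N).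
Proof. exact: big_split_ord. Qed.

End combinations.

Lemma big_ord_mul (V : nmodType) M N (F : nat -> V) :
  \sum_(k < M * N) F k = \sum_(q < M) \sum_(j < N) F (q * N + j)%N.
Proof.
elim: M F => [|M IH] F; first by rewrite mul0n !big_ord0.
rewrite mulSn big_split_ord big_ord_recl/=; congr (_ + _).
rewrite (IH (fun k => F (N + k)%N)); apply: eq_bigr => q _.
by apply: eq_bigr => j _; rewrite mulSn addnA.
Qed.

Notation fdot R I := (pi_dot I (mul_dot R)).

Section finite_dot.
Context (R : realType) (I : finType).
Implicit Types u v : I -> R^o.

Lemma fdotE u v : fdot R I u v = \sum_i u i * v i.
Proof. exact: pi_dotE. Qed.

Lemma comb_fctE (n : nat) (b : nat -> R) (Y : nat -> I -> R^o) i :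
  comb n b Y i = \sum_(j < n) b j * Y j i.
Proof. by rewrite /comb fct_sumE. Qed.

End finite_dot.

Definition absf (R : realType) (I : Type) (r : I -> R^o) : I -> R^o :=
  fun i => `|r i|.

(* [r] is required to be orthogonal to [absf r] and [d], so that the signed and
   the symmetric couplings do not mix when gadgets are combined. *)
Variant gadget (R : realType) (Q tau T : R) : Prop :=
  Gadget (I : finType) (N : nat) (Y : nat -> I -> R^o) (s b0 : nat -> R)
    (r d : I -> R^o) of
    (0 < N)%N
  & (forall j i, 0 <= Y j i)
  & (forall j, (j < N)%N -> 0 < nsq (fdot R I) (Y j))
  & (forall (b : nat -> R) m, (m <= N)%N ->
       nsq (fdot R I) (comb m b Y) <= Q * nsq (fdot R I) (comb N b Y))
  & (forall (b : nat -> R), \sum_(j < N) `|s j| * b j = fdot R I d (comb N b Y))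
  & (forall (b : nat -> R), \sum_(j < N) s j * b j = T * fdot R I r (comb N b Y))
  & comb N b0 Y = r
  & nsq (fdot R I) r = 1
  & nsq (fdot R I) d <= tau ^+ 2
  & (forall i, 0 <= d i)
  & fdot R I d r = 0
  & fdot R I r (absf r) = 0.

(** Take the unit vectors of R^4 with alternating signs. Four coordinates +-1/2 form a unit vector
    [r] with rational entries, orthogonal to constant vectors such as [d] and [absf r]. Nothing is
    amplified yet: both weights have size [tau]. *)
Lemma gadget_base (R : realType) (tau : R) : 0 <= tau -> gadget 1 tau tau.
Proof.
move=> tau0.
pose Y (j : nat) : 'I_4 -> R^o := fun i => (j == i :> nat)%:R.
pose sg (j : nat) : R := (-1) ^+ j.
have sg1 j : `|sg j| = 1 by rewrite /sg normrX normrN1 expr1n.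
have sg2 j : sg j * sg j = 1 by rewrite /sg -expr2 sqrr_sign.
have combY b (i : 'I_4) : comb 4 b Y i = b i.
  rewrite comb_fctE (bigD1 i)//= big1 ?addr0 /Y ?eqxx ?mulr1// => j ji.
  by rewrite -[j == i :> nat]/(j == i) (negbTE ji) mulr0.
have sum4 (c : R) : \sum_(i < 4) c = 4 * c.
  by rewrite sumr_const card_ord mulr_natl.
have sumsg : \sum_(i < 4) sg i = 0.
  by rewrite !big_ord_recl big_ord0/= /sg/= !exprS expr0; ring.
apply: (@Gadget R 1 tau tau 'I_4 4 Y (fun j => tau / 2 * sg j)
  (fun j => 1 / 2 * sg j) (fun i => 1 / 2 * sg i) (fun=> tau / 2)).
- by [].
- by move=> j i; rewrite /Y ler0n.
- move=> j j4; rewrite /nsq fdotE (bigD1 (Ordinal j4))//= ltr_pwDl//.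
    by rewrite /Y eqxx mulr1.
  by apply: sumr_ge0 => i _; rewrite /Y -natrM ler0n.
- move=> b m m4; rewrite mul1r -(comb_trunc b Y m4) /nsq !fdotE.
  apply: ler_sum => i _; rewrite !combY; case: ifP => // _.
  by rewrite mulr0 -expr2 sqr_ge0.
- move=> b; rewrite fdotE; apply: eq_bigr => i _.
  by rewrite combY normrM sg1 mulr1 ger0_norm// divr_ge0.
- move=> b; rewrite fdotE mulr_sumr; apply: eq_bigr => i _.
  by rewrite combY; field.
- by apply/funext => i; rewrite combY.
- rewrite /nsq fdotE (eq_bigr (fun=> 1 / 4)) ?sum4; first by field.
  by move=> i _; rewrite mulrACA sg2; field.
- rewrite /nsq fdotE sum4; have -> : 4 * (tau / 2 * (tau / 2)) = tau ^+ 2 by field.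
  by [].
- by move=> i; rewrite divr_ge0.
- rewrite fdotE (eq_bigr (fun i : 'I_4 => tau / 4 * sg i)).
    by rewrite -mulr_sumr sumsg mulr0.
  by move=> i _; field.
- rewrite fdotE (eq_bigr (fun i : 'I_4 => 1 / 4 * sg i)).
    by rewrite -mulr_sumr sumsg mulr0.
  by move=> i _; rewrite /absf normrM sg1 ger0_norm ?divr_ge0//; field.
Qed.

(** * The amplification step for gadgets *)

Section gadget_step.
Context (R : realType) (Q tau T : R).
Context (I : finType) (N : nat) (Y : nat -> I -> R^o) (s b0 : nat -> R).
Context (r d : I -> R^o) (theta : R) (m : nat).
Notation ip := (fdot R I).
Hypotheses (N0 : (0 < N)%N) (Y0 : forall j i, 0 <= Y j i).
Hypothesis Ygt0 : forall j, (j < N)%N -> 0 < nsq ip (Y j).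
Hypothesis Ybasis : forall (b : nat -> R) p, (p <= N)%N ->
  nsq ip (comb p b Y) <= Q * nsq ip (comb N b Y).
Hypothesis abssE : forall b : nat -> R,
  \sum_(j < N) `|s j| * b j = ip d (comb N b Y).
Hypothesis sE : forall b : nat -> R, \sum_(j < N) s j * b j = T * ip r (comb N b Y).
Hypotheses (b0E : comb N b0 Y = r) (r1 : nsq ip r = 1).
Hypotheses (dtau : nsq ip d <= tau ^+ 2) (d0 : forall i, 0 <= d i).
Hypotheses (dr : ip d r = 0) (rabs : ip r (absf r) = 0).
Hypotheses (tau0 : 0 <= tau) (tauT : tau <= T) (T0 : 0 < T).
Hypotheses (theta0 : 0 < theta) (theta1 : theta <= 1 / 4).
Hypotheses (m0 : (10 <= m)%N).
Hypothesis QQ : ((1 + 2 * theta) / (1 - 2 * theta)) ^+ 2 <= Q.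

(** A square number of copies, so that the factor normalising a vector repeated in all copies is
    1/m. *)
Let M := (m ^ 2)%N.
Let g : R := theta / (T * M%:R).
Let ipW : semi_inner ('I_M -> I -> R^o) := pi_dot 'I_M ip.

Let mR : 0 < m%:R :> R. Proof. by rewrite ltr0n (leq_trans _ m0). Qed.
Let M0 : 0 < M%:R :> R. Proof. by rewrite natrX exprn_gt0. Qed.
Let g0 : 0 < g. Proof. by rewrite divr_gt0// mulr_gt0. Qed.
Let gT : g * T * M%:R = theta.
Proof. by rewrite /g; field; rewrite !gt_eqF. Qed.

Lemma absr1 : nsq ip (absf r) = 1.
Proof.
rewrite -r1 /nsq !fdotE; apply: eq_bigr => i _.
by rewrite /absf -normrM ger0_norm// -expr2 sqr_ge0.
Qed.

(* The coupling strength [g] is chosen so that [g * T * M = theta]: along [r] the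
   feedback multiplies the sum over the copies by [1 - theta]. *)
Definition feedback_vec (v : I -> R^o) : I -> R^o :=
  g *: (ip d v *: absf r - (T * ip r v) *: r).

(** An operator of rank at most two: it sees only the sum over the copies and returns the same
    vector in each. Combinations of the new gadget are those of the copies acted on by identity plus
    [feedback]. *)
Definition feedback (y : 'I_M -> I -> R^o) : 'I_M -> I -> R^o :=
  fun=> feedback_vec (\sum_q y q).

Lemma feedback_vecD : {morph feedback_vec : u v / u + v}.
Proof.
move=> u v; rewrite /feedback_vec -scalerDr; congr (_ *: _).
by rewrite !dotDr mulrDr !scalerDl opprD addrACA.
Qed.

Lemma feedbackD : {morph feedback : u v / u + v}.
Proof.
move=> u v; apply/funext => q.
transitivity (feedback_vec (\sum_q u q + \sum_q v q)); last exact: feedback_vecD.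
by rewrite /feedback -big_split.
Qed.

(** The two terms are orthogonal, as [r] is orthogonal to [absf r], and each coefficient is at most
    g T |v| because tau <= T; finally g T = theta / M. *)
Lemma nsq_feedback_vec v : nsq ip (feedback_vec v) <= (2 * theta / M%:R) ^+ 2 * nsq ip v.
Proof.
have tE : 2 * theta / M%:R = 2 * g * T by rewrite -gT; field; rewrite gt_eqF.
rewrite tE /feedback_vec nsqZ nsqD nsqZ -scaleNr nsqZ absr1 r1.
rewrite dotZl dotZr (dotC ip (absf r)) rabs.
have h1 := le_trans (cauchy_schwarz ip d v) (ler_wpM2r (nsq_ge0 ip v) dtau).
have h2 := cauchy_schwarz ip r v; rewrite r1 mul1r in h2.
have h3 : tau ^+ 2 <= T ^+ 2 by rewrite ler_sqr ?nnegrE// ltW.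
have h4 := ler_wpM2r (nsq_ge0 ip v) h3.
have h5 := ler_wpM2l (sqr_ge0 T) h2.
have h6 : (ip d v) ^+ 2 + T ^+ 2 * (ip r v) ^+ 2 <= 2 * T ^+ 2 * nsq ip v by lra.
have h7 := ler_wpM2l (sqr_ge0 g) h6.
have h8 := mulr_ge0 (sqr_ge0 (g * T)) (nsq_ge0 ip v).
have -> : (2 * g * T) ^+ 2 * nsq ip v = 4 * ((g * T) ^+ 2 * nsq ip v) by ring.
lra.
Qed.

Lemma ipWE u v : ipW u v = \sum_q ip (u q) (v q). Proof. exact: pi_dotE. Qed.

Lemma nsqWE y : nsq ipW y = \sum_q nsq ip (y q). Proof. exact: pi_dotE. Qed.

Lemma nsq_cst (w : I -> R^o) : nsq ipW (fun=> w) = M%:R * nsq ip w.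
Proof. by rewrite nsqWE sumr_const card_ord mulr_natl. Qed.

Lemma feedback_le y : nsq ipW (feedback y) <= (2 * theta) ^+ 2 * nsq ipW y.
Proof.
rewrite /feedback nsq_cst.
apply: (le_trans (ler_wpM2l (ltW M0) (nsq_feedback_vec _))).
have := ler_wpM2l (sqr_ge0 (2 * theta / M%:R)) (nsq_sum ip y).
move/(ler_wpM2l (ltW M0)) => /le_trans; apply.
rewrite nsqWE.
rewrite le_eqVlt; apply/orP; left; apply/eqP; field.
by rewrite gt_eqF.
Qed.

(** Against the bound 2 theta for all copies together, restricting the input or the output to a
    single copy saves a factor sqrt M = m. *)
Lemma decoupled (q0 : 'I_M) (e h : 'I_M -> I -> R^o) :
  e q0 = 0 -> (forall q, q != q0 -> h q = 0) ->
  almost_decoupled ipW (2 * theta / m%:R) feedback e h.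
Proof.
move=> e0 h0.
have ipWh u : ipW u h = ip (u q0) (h q0).
  rewrite ipWE (bigD1 q0)// big1; first exact: addr0.
  by move=> q qq; rewrite h0// dot0r.
have sumh : \sum_q h q = h q0.
  by rewrite (bigD1 q0)//= big1 ?addr0.
have mM : M%:R = m%:R ^+ 2 :> R by rewrite natrX.
split.
- by rewrite ipWh e0 dot0l.
- rewrite {1}/feedback nsq_cst sumh.
  apply: (le_trans (ler_wpM2l (ltW M0) (nsq_feedback_vec _))).
  rewrite /nsq ipWh.
  rewrite le_eqVlt; apply/orP; left; apply/eqP; rewrite mM /nsq; field.
  by rewrite gt_eqF.
- rewrite ipWh /feedback; apply: (le_trans (cauchy_schwarz _ _ _)).
  have -> : nsq ipW h = nsq ip (h q0) by rewrite /nsq ipWh.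
  rewrite [leRHS]mulrA; apply: ler_wpM2r; first exact: nsq_ge0.
  apply: (le_trans (nsq_feedback_vec _)).
  apply: (le_trans (ler_wpM2l (sqr_ge0 _) (nsq_sum ip e))).
  rewrite nsqWE.
  rewrite le_eqVlt; apply/orP; left; apply/eqP; rewrite mM; field.
  by rewrite gt_eqF.
Qed.

Definition flat (y : 'I_M -> I -> R^o) : 'I_M * I -> R^o := fun p => y p.1 p.2.

Lemma dot_flat u v : fdot R ('I_M * I)%type (flat u) (flat v) = ipW u v.
Proof.
rewrite fdotE ipWE; under [RHS]eq_bigr do rewrite fdotE.
by rewrite (pair_bigA _ (fun q i => u q i * v q i)).
Qed.

(* The second term is [2 * g * max(0, - s_j r)]: copy [q] is coupled to [- r] in
   every copy, including itself, which makes the eigenvectors explicit. *)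
Definition Ystep (k : nat) : 'I_M * I -> R^o := fun p =>
  (p.1 == (k %/ N)%N :> nat)%:R * Y (k %% N)%N p.2 +
  g * (`|s (k %% N)%N| * `|r p.2| - s (k %% N)%N * r p.2).

Definition copy_comb (b : nat -> R) (q : 'I_M) : I -> R^o :=
  comb N (fun j => b (q * N + j)%N) Y.

Lemma divmod (q j : nat) : (j < N)%N ->
  ((((q * N + j) %/ N)%N = q) * (((q * N + j) %% N)%N = j))%type.
Proof. by move=> jN; rewrite divnMDl// divn_small// addn0 modnMDl modn_small. Qed.

Lemma comb_Ystep b : comb (M * N) b Ystep = flat (copy_comb b + feedback (copy_comb b)).
Proof.
apply/funext => -[q i].
rewrite comb_fctE (big_ord_mul M N (fun k => b k * Ystep k (q, i))) /flat/=.
transitivity (\sum_(p < M) ((p == q)%:R * copy_comb b p i +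
    g * (ip d (copy_comb b p) * `|r i| - T * ip r (copy_comb b p) * r i))).
  apply: eq_bigr => p _.
  rewrite -abssE -sE /copy_comb comb_fctE !mulr_suml -sumrB !mulr_sumr -big_split/=.
  apply: eq_bigr => j _; rewrite /Ystep/= !divmod// eq_sym.
  by rewrite -[p == q :> nat]/(p == q); ring.
rewrite big_split/= (bigD1 q)//= eqxx mul1r big1 ?addr0; last first.
  by move=> p /negbTE ->; rewrite mul0r.
rewrite -mulr_sumr sumrB -!mulr_suml -mulr_sumr -!dot_sumr.
by [].
Qed.

(** A truncation at [p] keeps the copies before [q0 = p / N], removes those after it and truncates
    copy [q0]. So [h] and [h'] are the contents of copy [q0], and [e] and [e'] those of the other
    copies, before and after truncation. *)
Lemma Ystep_basis b p : (p <= M * N)%N ->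
  nsq (fdot R ('I_M * I)%type) (comb p b Ystep) <=
  Q * ((1 + 5 * (2 * theta / m%:R)) / (1 - 5 * (2 * theta / m%:R))) *
  nsq (fdot R ('I_M * I)%type) (comb (M * N) b Ystep).
Proof.
set eta := 2 * theta / m%:R => pMN.
have m10 : 10 <= m%:R :> R by rewrite ler_nat.
have [t0 t1] := (theta0, theta1).
have eta0 : 0 <= eta by rewrite divr_ge0 ?mulr_ge0 ?ltW.
have eta1 : eta <= 1 / 10.
  by rewrite ler_pdivrMr//; lra.
have Q1 : 1 <= Q.
  apply: le_trans QQ; rewrite expr_ge1// ?ler_pdivlMr; lra.
(* Treated apart, since here [p / N] would be [M], which indexes no copy. *)
have [pE|pn] := eqVneq p (M * N)%N.
  rewrite pE -[leLHS]mul1r ler_wpM2r ?nsq_ge0//.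
  rewrite -[leLHS]mulr1; apply: ler_pM => //.
  by rewrite ler_pdivlMr; lra.
have {pMN pn} pMN : (p < M * N)%N by rewrite ltn_neqAle pn.
rewrite -(comb_trunc b Ystep (ltnW pMN)) !comb_Ystep /nsq !dot_flat.
have q0M : (p %/ N < M)%N by rewrite ltn_divLR.
pose q0 := Ordinal q0M.
pose bt := fun j => if (j < p)%N then b j else 0.
pose e q : I -> R^o := if q == q0 then 0 else copy_comb b q.
pose h q : I -> R^o := if q == q0 then copy_comb b q else 0.
pose e' (q : 'I_M) : I -> R^o := if (q < q0)%N then copy_comb b q else 0.
pose h' (q : 'I_M) : I -> R^o :=
  if q == q0 then comb (p %% N) (fun j => b (q0 * N + j)%N) Y else 0.
have ehE : copy_comb b = e + h.
  by apply/funext => q; rewrite fctE /e /h; case: ifP; rewrite ?add0r ?addr0.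
have pE : p = (p %/ N * N + p %% N)%N := divn_eq p N.
have ehE' : copy_comb bt = e' + h'.
  apply/funext => q; rewrite fctE /e' /h'; case: ltngtP => [qq|qq|/val_inj qq].
  - rewrite ifF ?addr0; last by apply/negbTE; rewrite -val_eqE ltn_eqF.
    apply: eq_comb => j jN; rewrite /bt ifT// pE ltn_addr//.
    apply: (@leq_trans (q.+1 * N)); rewrite ?leq_mul2r ?qq ?orbT//.
    by rewrite mulSn addnC ltn_add2r.
  - rewrite ifF ?addr0; last by apply/negbTE; rewrite -val_eqE gtn_eqF.
    apply: comb0 => j jN; rewrite /bt ifF//; apply/negbTE; rewrite -leqNgt pE.
    apply: (@leq_trans ((p %/ N).+1 * N)); last first.
      by rewrite (leq_trans _ (leq_addr _ _))// leq_mul2r qq orbT.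
    by rewrite mulSn addnC leq_add2r ltnW// ltn_pmod.
  - rewrite qq eqxx add0r -(comb_trunc _ Y (ltnW (ltn_pmod p N0))).
    by apply: eq_comb => j jN; rewrite /bt {1}pE ltn_add2l.
rewrite -/bt ehE ehE'.
have dec1 : almost_decoupled ipW eta feedback e h.
  by apply: (@decoupled q0); [rewrite /e eqxx|move=> q /negbTE qq; rewrite /h qq].
have dec2 : almost_decoupled ipW eta feedback e' h'.
  by apply: (@decoupled q0); [rewrite /e' ltnn|move=> q /negbTE qq; rewrite /h' qq].
have tt1 : 2 * theta <= 1 / 2 by lra.
have tt0 : 0 <= 2 * theta by lra.
apply: (perturbed_truncation tt0 tt1 eta0 eta1 feedbackD feedback_le dec1 dec2) => //.
- rewrite !nsqWE; apply: ler_sum => q _; rewrite /e' /e; case: ltngtP => qq.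
  + by rewrite ifF//; apply/negbTE; rewrite -val_eqE ltn_eqF.
  + by rewrite {1}/nsq dot0l; exact: nsq_ge0.
  + by rewrite {1}/nsq dot0l; exact: nsq_ge0.
- rewrite !nsqWE mulr_sumr; apply: ler_sum => q _; rewrite /h' /h.
  case: ifP => [/eqP ->|_].
  + by apply: Ybasis; rewrite ltnW// ltn_pmod.
  + by rewrite /nsq dot0l mulr0.
Qed.

(** On sums over the copies the functionals given by [d] and [r] are eigenvectors of the coupling:
    the first is multiplied by [1 + g M <d, absf r>] >= 1, the second by [1 - g T M = 1 - theta].
    Undoing these factors shrinks [d], so [tau] is kept, while [T] is divided by [1 - theta]. *)
Lemma gadget_next :
  gadget (Q * ((1 + 5 * (2 * theta / m%:R)) / (1 - 5 * (2 * theta / m%:R))))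
    tau (T / (1 - theta)).
Proof.
have [t0 t1] := (theta0, theta1).
have t2 : 0 < 1 - theta by lra.
have mn0 : m%:R != 0 :> R by rewrite gt_eqF.
have dabs : 0 <= ip d (absf r).
  by rewrite fdotE; apply: sumr_ge0 => i _; rewrite mulr_ge0 ?d0// normr_ge0.
have lam0 : 0 < 1 + g * M%:R * ip d (absf r).
  by rewrite ltr_wpDr// mulr_ge0// mulr_ge0// ltW.
pose lam := (1 + g * M%:R * ip d (absf r))^-1.
have dot_d_feedback v : ip d (feedback_vec v) = g * ip d (absf r) * ip d v.
  by rewrite /feedback_vec dotZr dotDr dotNr !dotZr dr; ring.
have dot_r_feedback v : ip r (feedback_vec v) = - (g * T) * ip r v.
  by rewrite /feedback_vec dotZr dotDr dotNr !dotZr rabs -[ip r r]/(nsq ip r) r1; ring.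
have mM : M%:R = m%:R ^+ 2 :> R by rewrite natrX.
have cst_dot (u : I -> R^o) y : ipW (fun=> u) y = ip u (\sum_q y q).
  by rewrite ipWE dot_sumr.
have sumK (y : 'I_M -> I -> R^o) :
    \sum_q (y + feedback y) q = \sum_q y q + M%:R *: feedback_vec (\sum_q y q).
  rewrite big_split/=; congr (_ + _).
  by rewrite sumr_const card_ord scaler_nat.
(* The new [r] is r/m in every copy, of norm 1 as M = m^2. The feedback scales a vector repeating
   [r] by [1 - theta], hence this factor in the new coefficients [b0]. *)
apply: (@Gadget R _ tau (T / (1 - theta)) _ (M * N) Ystep
  (fun k => s (k %% N)%N / m%:R)
  (fun k => (m%:R * (1 - theta))^-1 * b0 (k %% N)%N)
  (flat (fun=> m%:R^-1 *: r)) (flat (fun=> (lam / m%:R) *: d))).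
- by rewrite muln_gt0 N0 expn_gt0 (leq_trans _ m0).
- move=> k p; apply: addr_ge0; first by rewrite mulr_ge0.
  by rewrite mulr_ge0 ?(ltW g0)// subr_ge0 -normrM ler_norm.
- move=> k kMN.
  have qM : (k %/ N < M)%N by rewrite ltn_divLR.
  have jN : (k %% N < N)%N by rewrite ltn_mod.
  apply: (lt_le_trans (Ygt0 jN)).
  rewrite /nsq !fdotE -(pair_bigA _ (fun q i => Ystep k (q, i) * Ystep k (q, i))).
  rewrite (bigD1 (Ordinal qM))//= -[leLHS]addr0; apply: lerD; last first.
    by apply: sumr_ge0 => q _; apply: sumr_ge0 => i _; rewrite -expr2 sqr_ge0.
  have pos i : 0 <= g * (`|s (k %% N)%N| * `|r i| - s (k %% N)%N * r i).
    by rewrite mulr_ge0 ?(ltW g0)// subr_ge0 -normrM ler_norm.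
  apply: ler_sum => i _; rewrite /Ystep/= eqxx mul1r.
  by apply: ler_pM => //; rewrite lerDl.
- exact: Ystep_basis.
- move=> b; rewrite comb_Ystep dot_flat cst_dot sumK dotDr dotZr !dotZl dot_d_feedback.
  rewrite (big_ord_mul M N (fun k => `|s (k %% N)%N / m%:R| * b k)) dot_sumr.
  transitivity (m%:R^-1 * \sum_q ip d (copy_comb b q)).
    rewrite mulr_sumr; apply: eq_bigr => q _; rewrite -abssE mulr_sumr.
    apply: eq_bigr => j _; rewrite divmod// normrM normfV [`|m%:R|]ger0_norm//.
    by ring.
  by rewrite /lam; field; rewrite mn0 gt_eqF.
- move=> b; rewrite comb_Ystep dot_flat cst_dot sumK dotDr dotZr !dotZl dot_r_feedback.
  rewrite (big_ord_mul M N (fun k => s (k %% N)%N / m%:R * b k)) dot_sumr.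
  transitivity (m%:R^-1 * \sum_q (T * ip r (copy_comb b q))).
    rewrite mulr_sumr; apply: eq_bigr => q _; rewrite -sE mulr_sumr.
    by apply: eq_bigr => j _; rewrite divmod//; ring.
  rewrite -mulr_sumr.
  have -> : forall x y : R, y * x + M%:R * (y * (- (g * T) * x)) =
      y * (1 - g * T * M%:R) * x by move=> x y; ring.
  by rewrite gT; field; rewrite mn0 gt_eqF.
- rewrite comb_Ystep; congr flat; apply/funext => q.
  have copy_combE p : copy_comb (fun k => (m%:R * (1 - theta))^-1 * b0 (k %% N)%N) p =
      (m%:R * (1 - theta))^-1 *: r.
    rewrite /copy_comb -b0E -combZ; apply: eq_comb => j jN.
    by rewrite divmod.
  transitivity (copy_comb (fun k => (m%:R * (1 - theta))^-1 * b0 (k %% N)%N) q +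
    feedback_vec (\sum_p copy_comb (fun k => (m%:R * (1 - theta))^-1 * b0 (k %% N)%N) p)); first by [].
  rewrite (eq_bigr _ (fun p _ => copy_combE p)) copy_combE sumr_const card_ord -(scaler_nat M).
  rewrite /feedback_vec !dotZr dr -[ip r r]/(nsq ip r) r1 !mulr0 scale0r sub0r scalerN scalerA.
  rewrite -scalerBl; congr (_ *: _).
  have -> : g * (T * (M%:R * ((m%:R * (1 - theta))^-1 * 1))) =
    (g * T * M%:R) / (m%:R * (1 - theta)) by ring.
  by rewrite gT; field; rewrite mn0 gt_eqF.
- rewrite /nsq dot_flat cst_dot sumr_const card_ord -(scaler_nat M) !dotE.
  by rewrite -[ip r r]/(nsq ip r) r1 mM; field.
- rewrite /nsq dot_flat cst_dot sumr_const card_ord -(scaler_nat M) !dotE.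
  have -> : lam / m%:R * (M%:R * (lam / m%:R * ip d d)) = lam ^+ 2 * nsq ip d.
    by rewrite mM /nsq; field.
  apply: le_trans dtau; rewrite -[leRHS]mul1r; apply: ler_wpM2r; first exact: nsq_ge0.
  rewrite exprn_ile1 ?invr_ge0 ?(ltW lam0)// invf_le1// lerDl.
  by rewrite mulr_ge0// mulr_ge0// ltW.
- by move=> p; rewrite /flat mulr_ge0// mulr_ge0 ?invr_ge0 ?ltW.
- by rewrite dot_flat ipWE big1// => q _; rewrite !dotE dr !mulr0.
- transitivity (ipW (fun=> m%:R^-1 *: r) (fun=> m%:R^-1 *: absf r)).
    rewrite -dot_flat; congr (fdot _ _ _ _); apply/funext => p.
    by rewrite /absf /flat normrM ger0_norm// invr_ge0 ltW.
  by rewrite ipWE big1// => q _; rewrite !dotE rabs !mulr0.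
Qed.

End gadget_step.

Lemma gadget_le (R : realType) (Q Q' tau T : R) : Q <= Q' ->
  gadget Q tau T -> gadget Q' tau T.
Proof.
move=> QQ' [I N Y s b0 r d N0 Y0 Y1 YQ abssE sE b0E r1 dt d0 dr rr].
apply: (Gadget N0 Y0 Y1 _ abssE sE b0E r1 dt d0 dr rr) => b m mN.
by apply: (le_trans (YQ b m mN)); rewrite ler_wpM2r// nsq_ge0.
Qed.

(* [Q] does not grow with [n]: at each step the number of copies is taken large
   enough to fit the loss between the previous [Q] and the required one. *)
Lemma gadget_iter (R : realType) (theta : R) n (Q tau : R) :
  0 < theta -> theta <= 1 / 4 -> ((1 + 2 * theta) / (1 - 2 * theta)) ^+ 2 < Q ->
  0 < tau -> gadget Q tau (tau / (1 - theta) ^+ n).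
Proof.
move=> t0 t1 + tau0; set Q0 := (_ / _) ^+ 2.
have t2 : 0 < 1 - theta by lra.
have Q01 : 1 <= Q0 by rewrite /Q0 expr_ge1// ?ler_pdivlMr; lra.
elim: n Q => [|n IH] Q Q0Q.
  rewrite expr0 divr1; apply: gadget_le (gadget_base (ltW tau0)).
  by rewrite ltW// (le_lt_trans Q01).
pose Q' := (Q0 + Q) / 2.
have Q0Q' : Q0 < Q' by rewrite /Q'; lra.
have Q'Q : Q' < Q by rewrite /Q'; lra.
have [I N Y s b0 r d N0 Y0 Y1 YQ abssE sE b0E r1 dt d0 dr rr] := IH _ Q0Q'.
(* With eta = 2 theta / m <= 1/(2m) the step loses a factor of at most 1 + 20 eta, that is at most
   10 Q' / m in absolute terms; m > c makes this less than Q - Q'. *)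
pose c := 10 * Q' / (Q - Q').
pose m := (Num.bound c + 10)%N.
have cm : c < m%:R.
  apply: (lt_le_trans (archi_boundP _)); last by rewrite ler_nat leq_addr.
  by rewrite /c divr_ge0//; lra.
have m10 : (10 <= m)%N by rewrite leq_addl.
have m10R : 10 <= m%:R :> R by rewrite ler_nat.
have mgt0 : 0 < m%:R :> R by lra.
have tT : tau <= tau / (1 - theta) ^+ n.
  by rewrite ler_pdivlMr ?exprn_gt0// ler_piMr ?(ltW tau0)// exprn_ile1; lra.
have T0 : 0 < tau / (1 - theta) ^+ n by rewrite divr_gt0 ?exprn_gt0.
have := gadget_next N0 Y0 Y1 YQ abssE sE b0E r1 dt d0 dr rr (ltW tau0) tT T0
  t0 t1 m10 (ltW Q0Q').
have -> : tau / (1 - theta) ^+ n / (1 - theta) = tau / (1 - theta) ^+ n.+1.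
  by rewrite -mulrA -invfM -exprSr.
apply: gadget_le.
set eta := 2 * theta / m%:R.
have e0 : 0 <= eta by rewrite divr_ge0 ?mulr_ge0 ?ltW.
have em : eta * m%:R <= 1 / 2 by rewrite /eta mulfVK ?gt_eqF//; lra.
have e1 : eta <= 1 / 20.
  have h : eta * 10 <= eta * m%:R by exact: ler_wpM2l.
  by lra.
apply: (@le_trans _ _ (Q' * (1 + 20 * eta))).
  apply: ler_wpM2l; first by lra.
  by rewrite ler_pdivrMr; nra.
suff : Q' * (20 * eta) <= Q - Q' by lra.
have h1 : 10 * Q' < (Q - Q') * m%:R.
  by move: cm; rewrite /c ltr_pdivrMr; [lra|lra].
rewrite -(ler_pM2r mgt0).
have h2 : Q' * (20 * eta) * m%:R <= Q' * 10.
  rewrite -mulrA; apply: ler_wpM2l; lra.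
lra.
Qed.

(** Work backwards: start from [tau = T (1 - theta)^n], tiny for large [n], and amplify [n] times to
    reach [T] exactly. *)
Lemma gadget_exists (R : realType) (theta Q T tau0 : R) :
  0 < theta -> theta <= 1 / 4 -> ((1 + 2 * theta) / (1 - 2 * theta)) ^+ 2 < Q ->
  0 < T -> 0 < tau0 -> exists2 tau, 0 < tau <= tau0 & gadget Q tau T.
Proof.
move=> t0 t1 QQ T0 tau00.
have t2 : 0 < 1 - theta by lra.
have /cvgrPdist_lt /(_ _ (divr_gt0 tau00 T0)) :
    (1 - theta) ^+ n @[n --> \oo] --> 0.
  by apply: cvg_expr; rewrite ger0_norm; lra.
move=> [n _ /(_ n (leqnn n))] /=.
rewrite sub0r normrN ger0_norm ?exprn_ge0 ?ltW// => h.
exists (T * (1 - theta) ^+ n).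
  rewrite mulr_gt0 ?exprn_gt0//= mulrC -ler_pdivlMr// ltW//.
have := @gadget_iter _ theta n Q (T * (1 - theta) ^+ n) t0 t1 QQ.
by rewrite mulfK ?gt_eqF ?exprn_gt0//; apply; rewrite mulr_gt0 ?exprn_gt0.
Qed.

(** * Basic sequences *)

Section basic_sequences.
Context (R : realType) (V : lmodType R) (ip : semi_inner V).
Implicit Types (z : nat -> V) (a : nat -> R).

Lemma nsqN v : nsq ip (- v) = nsq ip v.
Proof. by rewrite /nsq !dotE opprK. Qed.

Lemma nsqD_le2 u v : nsq ip (u + v) <= 2 * (nsq ip u + nsq ip v).
Proof. by rewrite nsqD; have := ler_normlW (dot_amgm1 ip u v); lra. Qed.

Lemma nsq_dist_le2 u v w :
  nsq ip (u - w) <= 2 * (nsq ip (u - v) + nsq ip (v - w)).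
Proof. by rewrite -(subrKA v); exact: nsqD_le2. Qed.

Lemma combN n a z : comb n (fun j => - a j) z = - comb n a z.
Proof.
by rewrite -scaleN1r -combZ; apply: eq_comb => j _; rewrite mulN1r.
Qed.

Lemma combB n a a' z : comb n (fun j => a j - a' j) z = comb n a z - comb n a' z.
Proof. by rewrite -combN -combD. Qed.

Lemma combS n a z : comb n.+1 a z = comb n a z + a n *: z n.
Proof. by rewrite /comb big_ord_recr. Qed.

Lemma eq_combr n a z z' : (forall j, (j < n)%N -> z j = z' j) ->
  comb n a z = comb n a z'.
Proof. by move=> zz; apply: eq_bigr => j _; rewrite zz. Qed.

Lemma dot_comb0 n a z v : (forall j, (j < n)%N -> ip v (z j) = 0) ->
  ip v (comb n a z) = 0.
Proof.
by move=> h; rewrite dot_sumr big1// => j _; rewrite dotZr h ?mulr0.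
Qed.

(** Gram-Schmidt by induction: [u] and [v] are the residuals of [h] and [z n] with respect to the
    first [n] vectors, and [u] is then made orthogonal to [v]. *)
Lemma orthogonal_residual n z h :
  exists a, forall j, (j < n)%N -> ip (h - comb n a z) (z j) = 0.
Proof.
elim: n h => [|n IH] h; first by exists (fun=> 0).
have [a ha] := IH h; have [c hc] := IH (z n).
pose v := z n - comb n c z; pose u := h - comb n a z.
pose t := ip u (z n) / nsq ip v.
have uv : ip u v = ip u (z n).
  by rewrite /v dotDr dotNr (dot_comb0 _ ha) subr0.
have vv : ip v (z n) = nsq ip v.
  by rewrite /nsq {3}/v dotDr dotNr (dot_comb0 _ hc) subr0.
have tE : t * nsq ip v = ip u (z n).
  (* If [v] has norm zero the equation reads 0 = <u,v>, which holds by Cauchy-Schwarz. *)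
  rewrite /t; have [v0|v0] := eqVneq (nsq ip v) 0; last by rewrite mulfVK.
  rewrite v0 mulr0 -uv; apply/esym/eqP; rewrite -sqrf_eq0 eq_le sqr_ge0 andbT.
  by apply: (le_trans (cauchy_schwarz _ _ _)); rewrite v0 mulr0.
pose a' j := if (j < n)%N then a j - t * c j else t.
exists a' => j; rewrite combS {2}/a' ltnn.
rewrite (@eq_comb _ _ n a' (fun j => a j - t * c j)); last first.
  by move=> i; rewrite /a' => ->.
rewrite combB combZ.
have -> : h - (comb n a z - t *: comb n c z + t *: z n) = u - t *: v.
  rewrite /u /v scalerBr !opprD !opprK -!addrA; congr (_ + (_ + _)).
  exact: addrC.
rewrite ltnS leq_eqVlt => /predU1P[->|jn].
  by rewrite dotDl dotNl dotZl vv tE subrr.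
by rewrite dotDl dotNl dotZl hc// ha// mulr0 subrr.
Qed.

(** With squared norms, [D] bounds the square of the basis constant. *)
Definition basis_upto (D : R) n z := forall a m, (m <= n)%N ->
  nsq ip (comb m a z) <= D * nsq ip (comb n a z).

(** * Appending one block to a finite sequence *)

Section block_step.
Context (z : nat -> V) (n : nat) (D Q tau T : R).
Context (I : finType) (N : nat) (Y : nat -> I -> R^o) (s b0 : nat -> R).
Context (r d : I -> R^o) (e : I -> V) (x ax : V).
Notation dI := (fdot R I).
Hypothesis Ybasis : forall (b : nat -> R) p, (p <= N)%N ->
  nsq dI (comb p b Y) <= Q * nsq dI (comb N b Y).
Hypothesis abssE : forall b : nat -> R,
  \sum_(j < N) `|s j| * b j = dI d (comb N b Y).
Hypothesis sE : forall b : nat -> R, \sum_(j < N) s j * b j = T * dI r (comb N b Y).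
Hypotheses (b0E : comb N b0 Y = r) (r1 : nsq dI r = 1).
Hypotheses (dtau : nsq dI d <= tau ^+ 2) (dr : dI d r = 0).
Hypotheses (tau0 : 0 <= tau) (tau1 : tau < 1) (tauT : tau <= T) (D1 : 1 <= D).
Hypothesis QD : Q * (1 + T ^+ 2) <= D.
Hypothesis zD : basis_upto D n z.
Hypothesis e1 : forall i j, ip (e i) (e j) = (i == j)%:R.
Hypothesis ez : forall i j, (j < n)%N -> ip (e i) (z j) = 0.
Hypotheses (ex : forall i, ip (e i) x = 0) (eax : forall i, ip (e i) ax = 0).
Hypothesis xz : forall j, (j < n)%N -> ip x (z j) = 0.
Hypotheses (x1 : nsq ip x <= 1) (ax1 : nsq ip ax <= 1).
Variable z' : nat -> V.
Hypothesis z'z : forall j, (j < n)%N -> z' j = z j.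
(** For [ax] the absolute value of [x] the last term is max(0, s_j x). Here [x] and [ax] are
    abstract vectors; only norm bounds and orthogonality relations enter. *)
Hypothesis z'E : forall j, (j < N)%N ->
  z' (n + j)%N = \sum_i Y j i *: e i + 2^-1 *: (`|s j| *: ax + s j *: x).

Let E (u : I -> R^o) := \sum_i u i *: e i.

Let nsqE u : nsq ip (E u) = nsq dI u.
Proof.
rewrite /nsq fdotE /E dot_suml; apply: eq_bigr => i _.
rewrite dot_sumr (bigD1 i)//= big1 ?addr0 => [|j ji].
  by rewrite dotZl dotZr e1 eqxx mulr1.
by rewrite dotZl dotZr e1 eq_sym (negbTE ji) !mulr0.
Qed.

Let dotE0 u v : (forall i, ip (e i) v = 0) -> ip (E u) v = 0.
Proof. by move=> h; rewrite dot_suml big1// => i _; rewrite dotZl h mulr0. Qed.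

Let w b := comb N b (fun j => z' (n + j)%N).

Let tail b := 2^-1 *: (dI d (comb N b Y) *: ax + (T * dI r (comb N b Y)) *: x).

Lemma block_combE b : w b = E (comb N b Y) + tail b.
Proof.
rewrite /w /tail -abssE -sE !scaler_suml -big_split/= scaler_sumr.
have -> : E (comb N b Y) = \sum_(j < N) \sum_i (b j * Y j i) *: e i.
  rewrite /E exchange_big/=; apply: eq_bigr => i _.
  by rewrite comb_fctE scaler_suml.
rewrite -big_split/=; apply: eq_bigr => j _.
rewrite z'E// scalerDr scaler_sumr; congr (_ + _).
  by apply: eq_bigr => i _; rewrite scalerA.
rewrite scalerA (mulrC (b j)) -[LHS]scalerA; congr (_ *: _).
by rewrite scalerDr !scalerA !(mulrC (b j)).
Qed.

Let dot_tail b u : (forall i, ip (e i) u = 0) -> ip u x = 0 ->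
  ip u (w b) = 2^-1 * (dI d (comb N b Y) * ip u ax).
Proof.
move=> eu ux; rewrite block_combE dotDr dotC dotE0// add0r /tail.
by rewrite dotZr dotDr !dotZr ux !mulr0 addr0.
Qed.

Let dot_dle b : dI d (comb N b Y) ^+ 2 <= tau ^+ 2 * nsq dI (comb N b Y).
Proof.
apply: (le_trans (cauchy_schwarz _ _ _)).
by apply: ler_wpM2r dtau; exact: nsq_ge0.
Qed.

Let nsq_w b : nsq ip (w b) = nsq dI (comb N b Y) + nsq ip (tail b).
Proof.
rewrite block_combE nsqD nsqE dotE0 ?mulr0 ?addr0// => i.
by rewrite dotZr dotDr !dotZr eax ex !mulr0 addr0 mulr0.
Qed.

(** Both coefficients in [tail] are at most T times the norm of the combination, as tau <= T. Hence
    within a block the squared constant grows from Q to at most Q (1 + T^2). *)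
Let nsq_tail b : nsq ip (tail b) <= T ^+ 2 * nsq dI (comb N b Y).
Proof.
rewrite /tail nsqZ; have := nsqD_le2 (dI d (comb N b Y) *: ax)
  ((T * dI r (comb N b Y)) *: x); rewrite !nsqZ => h.
have h1 := dot_dle b.
have h2 := cauchy_schwarz dI r (comb N b Y); rewrite r1 mul1r in h2.
have h3 : tau ^+ 2 <= T ^+ 2.
  by rewrite ler_sqr ?nnegrE// (le_trans tau0).
have h4 := ler_wpM2r (nsq_ge0 dI (comb N b Y)) h3.
have h5 := ler_wpM2l (sqr_ge0 T) h2.
have h6 := ler_wpM2l (sqr_ge0 (dI d (comb N b Y))) ax1.
have h7 := ler_wpM2l (sqr_ge0 (T * dI r (comb N b Y))) x1.
lra.
Qed.

(** The old span is orthogonal to every [e i] and to [x], so the block meets it only through [ax],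
    whose coefficient is governed by [tau] and not by [T]. *)
Let angle a b : `|2 * ip (comb n a z) (w b)| <=
  tau * (nsq ip (comb n a z) + nsq ip (w b)).
Proof.
apply: dot_amgm => //; rewrite dot_tail; last 2 first.
- by move=> i; apply: dot_comb0 => j jn; exact: ez.
- by rewrite dotC; apply: dot_comb0 => j jn; exact: xz.
set v := comb n a z.
have h1 := dot_dle b.
have h2 := cauchy_schwarz ip v ax.
have h3 := ler_wpM2l (nsq_ge0 ip v) ax1.
have h4 : nsq dI (comb N b Y) <= nsq ip (w b) by rewrite nsq_w lerDl nsq_ge0.
have h5 : ip v ax ^+ 2 <= nsq ip v by lra.
have h6 := ler_pM (sqr_ge0 _) (sqr_ge0 _) h1 h5.
have h7 := ler_wpM2l (mulr_ge0 (sqr_ge0 tau) (nsq_ge0 ip v)) h4.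
have h8 := mulr_ge0 (sqr_ge0 (dI d (comb N b Y))) (sqr_ge0 (ip v ax)).
have -> : (2^-1 * (dI d (comb N b Y) * ip v ax)) ^+ 2 =
  (dI d (comb N b Y)) ^+ 2 * ip v ax ^+ 2 / 4 by field.
lra.
Qed.

Lemma block_gt0 j : (j < N)%N -> 0 < nsq dI (Y j) -> 0 < nsq ip (z' (n + j)%N).
Proof.
move=> jN Yj.
pose b k : R := (k == j)%:R.
have cb (W : lmodType R) (X : nat -> W) : comb N b X = X j.
  rewrite /comb (bigD1 (Ordinal jN))//= big1 ?addr0 => [|k kj].
    by rewrite /b eqxx scale1r.
  by rewrite /b -[k == j :> nat]/(k == Ordinal jN) (negbTE kj) scale0r.
have := nsq_w b; rewrite /w !cb => ->.
by rewrite ltr_wpDr// nsq_ge0.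
Qed.

(** Up to the factor (1 + tau) / (1 - tau) the old part and the block are orthogonal. A truncation
    affects only one of the two, at cost [D] for the old part or Q (1 + T^2) <= D for the block. *)
Lemma block_basis : basis_upto (D * ((1 + tau) / (1 - tau))) (n + N) z'.
Proof.
move=> a p pnN.
have [t0 t1] := (tau0, tau1); have D1' := D1.
have t2 : 0 < 1 - tau by lra.
have combz m : (m <= n)%N -> comb m a z' = comb m a z.
  by move=> mn; apply: eq_combr => j jm; rewrite z'z// (leq_trans jm).
set v := comb n a z; set b := fun j => a (n + j)%N.
have -> : comb (n + N) a z' = v + w b by rewrite comb_add combz.
have := angle a b; rewrite ler_norml -/v => /andP[ang _].
have v0 := nsq_ge0 ip v; have w0 := nsq_ge0 ip (w b).
have low : (1 - tau) * (nsq ip v + nsq ip (w b)) <= nsq ip (v + w b).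
  by rewrite nsqD; lra.
rewrite [D * _]mulrA mulrAC ler_pdivlMr//.
suff up : nsq ip (comb p a z') <= (1 + tau) * (D * (nsq ip v + nsq ip (w b))).
  apply: (le_trans (ler_wpM2r (ltW t2) up)).
  have := ler_wpM2l (_ : 0 <= D * (1 + tau)) low.
  rewrite mulr_ge0; [|lra|lra]; move=> /(_ isT); lra.
have [pn|np] := leqP p n.
  rewrite combz//; apply: (le_trans (zD a pn)); rewrite -/v.
  have := mulr_ge0 (_ : 0 <= D) v0; rewrite (le_trans _ D1)// => /(_ isT) Dv.
  have := mulr_ge0 (_ : 0 <= D) w0; rewrite (le_trans _ D1)// => /(_ isT) Dw.
  have := mulr_ge0 t0 Dv; have := mulr_ge0 t0 Dw; lra.
have pE : p = (n + (p - n))%N by rewrite subnKC// ltnW.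
have mN : (p - n <= N)%N by rewrite leq_subLR.
pose bt k := if (k < p - n)%N then b k else 0.
have -> : comb p a z' = v + w bt.
  by rewrite pE comb_add combz// /w (comb_trunc _ _ mN).
have := angle a bt; rewrite ler_norml -/v => /andP[_ ang2].
have : nsq ip (w bt) <= D * nsq ip (w b).
  have h1 : nsq ip (w bt) <= (1 + T ^+ 2) * nsq dI (comb N bt Y).
    by rewrite nsq_w; have := nsq_tail bt; lra.
  have h2 := Ybasis b mN; rewrite -(comb_trunc b Y mN) -/bt in h2.
  have T1 : 0 <= 1 + T ^+ 2 by rewrite addr_ge0 ?sqr_ge0.
  have h3 := ler_wpM2l T1 h2.
  have h4 := ler_wpM2r (nsq_ge0 dI (comb N b Y)) QD.
  have h5 : nsq dI (comb N b Y) <= nsq ip (w b) by rewrite nsq_w lerDl nsq_ge0.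
  have h6 := ler_wpM2l (le_trans ler01 D1) h5.
  lra.
have : nsq ip v <= D * nsq ip v by rewrite ler_peMl.
move=> Dv Dw.
have := nsqD ip v (w bt); set X := nsq ip (v + w bt) => XE.
have h : nsq ip v + nsq ip (w bt) <= D * (nsq ip v + nsq ip (w b)) by lra.
have := ler_wpM2l (_ : 0 <= 1 + tau) h.
rewrite addr_ge0// => /(_ isT); lra.
Qed.

Lemma block_residual nu :
  exists b, nsq ip (nu *: x - w b) <= nu ^+ 2 / (1 + T ^+ 2 / 4).
Proof.
have T1 : 0 < 1 + T ^+ 2 / 4 by rewrite ltr_wpDr// divr_ge0// sqr_ge0.
(* Since <d,r> = 0, the combination with coefficients [lam b0] has no [ax] component: it is lam (E r
   + (T/2) x). This [lam] is the least squares choice for a unit vector [x]. *)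
pose lam := nu * (T / 2) / (1 + T ^+ 2 / 4).
exists (fun j => lam * b0 j).
rewrite block_combE /tail combZ b0E !dotZr dr -[dI r r]/(nsq dI r) r1.
have -> : nu *: x - (E (lam *: r) +
    2^-1 *: ((lam * 0) *: ax + (T * (lam * 1)) *: x)) =
    - E (lam *: r) + (nu - lam * T / 2) *: x.
  rewrite mulr0 scale0r add0r scalerA scalerBl opprD addrCA; congr (_ + (_ - _ *: x)).
  by field.
rewrite nsqD nsqN nsqE !nsqZ r1 dotNl dotE0; last by move=> i; rewrite dotZr ex mulr0.
rewrite oppr0 mulr0 addr0.
have := ler_wpM2l (sqr_ge0 (nu - lam * T / 2)) x1; rewrite mulr1 => h.
have -> : nu ^+ 2 / (1 + T ^+ 2 / 4) = lam ^+ 2 * 1 + (nu - lam * T / 2) ^+ 2.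
  by rewrite /lam; field; move: T1; lra.
by lra.
Qed.

End block_step.

(** * Existence and uniqueness of expansions *)

Section expansions.
Context (z : nat -> V) (D : R).
Hypothesis zD : forall n, basis_upto D n z.
Hypothesis z0 : forall j, 0 < nsq ip (z j).

Definition expands (a : nat -> R) f := forall delta, 0 < delta ->
  exists n0, forall n, (n0 <= n)%N -> nsq ip (f - comb n a z) <= delta.

Let D1 : 1 <= D.
Proof.
have := zD (fun=> 1) (leqnn 1).
by rewrite /comb big_ord1 scale1r -[X in X <= _]mul1r ler_pM2r.
Qed.

(** A single term is the difference of two consecutive partial sums. *)
Lemma coef_bound a j n : (j < n)%N ->
  a j ^+ 2 * nsq ip (z j) <= 4 * D * nsq ip (comb n a z).
Proof.
move=> jn; rewrite -nsqZ.
have -> : a j *: z j = comb j.+1 a z - comb j a z by rewrite combS addrC addKr.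
apply: (le_trans (nsqD_le2 _ _)); rewrite nsqN.
by have := zD a jn; have := zD a (ltnW jn); lra.
Qed.

Lemma expands_unique f a a' : expands a f -> expands a' f -> a = a'.
Proof.
move=> fa fa'; apply/funext => j; apply/eqP; rewrite -subr_eq0 -sqrf_eq0.
rewrite eq_le sqr_ge0 andbT -(pmulr_lle0 _ (z0 j)).
apply/ler_addgt0Pl => delta delta0; rewrite addr0.
have D0 : 0 < D by rewrite (lt_le_trans ltr01).
(* 16 D is 4 from comparing two approximations of [f], times 4 D from [coef_bound]. *)
have d0 : 0 < delta / (16 * D) by rewrite divr_gt0// mulr_gt0.
have [n1 h1] := fa _ d0; have [n2 h2] := fa' _ d0.
pose n := maxn j.+1 (maxn n1 n2).
apply: (le_trans (@coef_bound (fun j => a j - a' j) j n (leq_maxl _ _))).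
rewrite combB.
have {}h1 := h1 n (leq_trans (leq_maxl _ _) (leq_maxr _ _)).
have {}h2 := h2 n (leq_trans (leq_maxr _ _) (leq_maxr _ _)).
have h3 := nsq_dist_le2 (comb n a z) f (comb n a' z).
rewrite -[nsq ip (comb n a z - f)]nsqN opprB in h3.
have h4 : nsq ip (comb n a z - comb n a' z) <= 4 * (delta / (16 * D)) by lra.
have := ler_wpM2l (_ : 0 <= 4 * D) h4; rewrite mulr_ge0 ?(ltW D0)// => /(_ isT).
have -> : 4 * D * (4 * (delta / (16 * D))) = delta by field; rewrite gt_eqF.
by [].
Qed.

(** The intervals of radius [c k] around [u k] meet pairwise, so the supremum of the left ends lies
    in all of them. *)
Lemma cauchy_limit (u : nat -> R) (C : R) : 0 <= C ->
  (forall k l, (k <= l)%N -> (u k - u l) ^+ 2 <= C / k.+1%:R) ->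
  exists a : R, forall k, (u k - a) ^+ 2 <= C / k.+1%:R.
Proof.
move=> C0 h; pose c k := Num.sqrt (C / k.+1%:R).
have c0 k : 0 <= c k by exact: sqrtr_ge0.
have cE k : c k ^+ 2 = C / k.+1%:R by rewrite sqr_sqrtr// divr_ge0.
have sqr_c (t : R) k : (t ^+ 2 <= C / k.+1%:R) = (- c k <= t <= c k).
  by rewrite -cE -ler_norml -[t ^+ 2]real_normK ?num_real// ler_sqr ?nnegrE.
have cross k l : u k - c k <= u l + c l.
  have := h _ _ (leq_maxl k l); have := h _ _ (leq_maxr k l).
  by rewrite !sqr_c => /andP[h1 h2] /andP[h3 h4]; lra.
pose A := [set u k - c k | k in [set: nat]]%classic.
have supA : has_sup A.
  split; first by exists (u 0%N - c 0%N), 0%N.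
  by exists (u 0%N + c 0%N) => _ [k _ <-]; exact: cross.
exists (sup A) => k; rewrite sqr_c; apply/andP; split.
  have : sup A <= u k + c k.
    by apply: ge_sup => [|_ [l _ <-]]; [case: supA|exact: cross].
  by lra.
have : u k - c k <= sup A by apply: ub_le_sup; [case: supA|exists k].
by lra.
Qed.

Hypothesis dense : forall f delta, 0 < delta ->
  exists n (a : nat -> R), nsq ip (f - comb n a z) <= delta.

(** Elements [b k] of the span tending to [f] have Cauchy coefficients by [coef_bound]. Since [f] is
    given, only these real coefficients have to converge; their limits [a] give the expansion. *)
Lemma expands_exists f : exists a : nat -> R, expands a f.
Proof.
have D0 : 0 < D by rewrite (lt_le_trans ltr01).
have /choice[n_ /choice[a_ aE]] : forall k, exists n a,
    nsq ip (f - comb n a z) <= (k.+1%:R)^-1.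
  by move=> k; apply: dense; rewrite invr_gt0.
pose b k j := if (j < n_ k)%N then a_ k j else 0.
have bE k n : (n_ k <= n)%N -> comb n (b k) z = comb (n_ k) (a_ k) z.
  exact: comb_trunc.
have bk k n : (n_ k <= n)%N -> nsq ip (f - comb n (b k) z) <= (k.+1%:R)^-1.
  by move=> kn; rewrite bE.
(* Uniform in the length [n], since a partial sum is bounded by a longer one that contains both
   approximants entirely. *)
have bkl k l n : (k <= l)%N ->
    nsq ip (comb n (fun j => b k j - b l j) z) <= 4 * D / k.+1%:R.
  move=> kl; pose m := maxn n (maxn (n_ k) (n_ l)).
  apply: (le_trans (zD _ (leq_maxl n (maxn (n_ k) (n_ l))))); rewrite -/m combB.
  have h1 := bk k m (leq_trans (leq_maxl _ _) (leq_maxr _ _)).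
  have h2 := bk l m (leq_trans (leq_maxr _ _) (leq_maxr _ _)).
  have h3 := nsq_dist_le2 (comb m (b k) z) f (comb m (b l) z).
  rewrite -[nsq ip (comb m (b k) z - f)]nsqN opprB in h3.
  have h4 : (l.+1%:R)^-1 <= (k.+1%:R)^-1 :> R by rewrite lef_pV2 ?posrE// ler_nat.
  have h5 : nsq ip (comb m (b k) z - comb m (b l) z) <= 4 * (k.+1%:R)^-1.
    move: h1 (le_trans h2 h4) h3; move: (k.+1%:R)^-1 => c; lra.
  by have := ler_wpM2l (ltW D0) h5; rewrite mulrCA mulrA.
have /choice[a ha] : forall j, exists aj : R, forall k,
    (b k j - aj) ^+ 2 <= 16 * D ^+ 2 / nsq ip (z j) / k.+1%:R.
  move=> j; apply: cauchy_limit => [|k l kl].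
    by rewrite divr_ge0 ?nsq_ge0// mulr_ge0 ?sqr_ge0.
  rewrite mulrAC ler_pdivlMr//.
  apply: (le_trans (@coef_bound (fun j => b k j - b l j) j _ (ltnSn j))).
  have := ler_wpM2l (_ : 0 <= 4 * D) (bkl k l j.+1 kl).
  rewrite mulr_ge0 ?(ltW D0)// => /(_ isT) /le_trans; apply.
  move: (k.+1%:R)^-1 => c; lra.
have small n delta : 0 < delta -> exists l0, forall l, (l0 <= l)%N ->
    nsq ip (comb n (fun j => b l j - a j) z) <= delta.
  move=> delta0.
  pose C := n%:R * (n%:R * (16 * D ^+ 2)).
  exists (Num.bound (C / delta)) => l hl.
  have C0 : 0 <= C by rewrite !mulr_ge0 ?(ltW D0).
  have h1 : C / delta < l.+1%:R.
    by rewrite (lt_le_trans (archi_boundP _)) ?divr_ge0 ?(ltW delta0)// ler_nat ltnW.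
  apply: (le_trans (nsq_sum _ _)).
  apply: (@le_trans _ _ (C / l.+1%:R)).
    rewrite -mulrA ler_wpM2l//.
    rewrite -mulrA mulr_natl -[n in leRHS]card_ord -sumr_const.
    apply: ler_sum => j _; rewrite nsqZ.
    have := ler_wpM2r (nsq_ge0 ip (z j)) (ha j l).
    suff -> : 16 * D ^+ 2 / nsq ip (z j) / l.+1%:R * nsq ip (z j) =
      16 * D ^+ 2 / l.+1%:R by [].
    by field; rewrite gt_eqF ?z0 // gt_eqF.
  by rewrite ler_pdivrMr// [leRHS]mulrC -ler_pdivrMr// ltW.
exists a => delta delta0.
pose k := Num.bound ((2 + 32 * D) / delta).
have kd : (2 + 32 * D) / k.+1%:R <= delta.
  rewrite ler_pdivrMr// [leRHS]mulrC -ler_pdivrMr// ltW//.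
  rewrite (lt_le_trans (archi_boundP _)) ?ler_nat//.
  by rewrite divr_ge0 ?(ltW delta0)// addr_ge0// mulr_ge0// ltW.
exists (n_ k) => n kn.
have d1 : 0 < D / k.+1%:R by rewrite divr_gt0.
(* Here [l] may depend on [n], because the bound between [b k] and [b l] depends on neither. *)
have [l0 hl] := small n (D / k.+1%:R) d1.
pose l := maxn k l0.
have h1 := bk k n kn.
have h2 := bkl k l n (leq_maxl _ _).
have h3 := hl l (leq_maxr _ _).
rewrite combB in h2; rewrite combB in h3.
have h4 := nsq_dist_le2 f (comb n (b k) z) (comb n a z).
have h5 := nsq_dist_le2 (comb n (b k) z) (comb n (b l) z) (comb n a z).
apply: le_trans kd.
move: h1 h2 h3 h4 h5 d1; move: (k.+1%:R)^-1 => c; lra.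
Qed.

End expansions.

End basic_sequences.

(** * The space of square-integrable functions *)

Lemma le1_2e (R : realType) : (1 <= 2%:E :> \bar R)%E.
Proof. by rewrite lee_fin ler1n. Qed.

Notation L2fun R := (LfunType (@lebesgue_measure R) (le1_2e R)).

Section L2_inner_product.
Context (R : realType).
Notation mu := (@lebesgue_measure R).
Notation V := (L2fun R).
Implicit Types f g : V.

Lemma L2fun_addE f g x : (f + g) x = f x + g x. Proof. by []. Qed.
Lemma L2fun_scaleE a f x : (a *: f) x = a * f x. Proof. by []. Qed.
Lemma L2fun_oppE f x : (- f) x = - f x. Proof. by []. Qed.
Lemma L2fun_0E x : (0 : V) x = 0. Proof. by []. Qed.

Lemma L2fun_sumE (I : Type) (r : seq I) (P : pred I) (F : I -> V) x :
  (\sum_(i <- r | P i) F i) x = \sum_(i <- r | P i) F i x.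
Proof. by elim/big_rec2 : _ => // i y v _ <-. Qed.

Lemma L2fun_combE n a (z : nat -> V) x :
  comb n a z x = \sum_(j < n) a j * z j x.
Proof. exact: L2fun_sumE. Qed.

Lemma integrable_mul f g : mu.-integrable setT (EFin \o (fun x => f x * g x)).
Proof.
apply/Lfun1_integrable; exact: (Lfun2_mul_Lfun1 (LfunP f) (LfunP g)).
Qed.

Definition L2dot_subdef : semi_inner V.
Proof.
apply: (@SemiInner R V (fun f g => \int[mu]_x (f x * g x))%R) => [u v|a u v w|u].
- by apply: eq_Rintegral => x _; rewrite mulrC.
- rewrite -RintegralZl//; last exact: integrable_mul.
  rewrite -RintegralD//; last 2 first.
  - exact: (integrableZl measurableT a (integrable_mul u w)).
  - exact: integrable_mul.
  by apply: eq_Rintegral => x _; rewrite mulrA -mulrDl.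
- by apply: Rintegral_ge0 => x _; rewrite -expr2 sqr_ge0.
Defined.

End L2_inner_product.

HB.lock Definition L2dot (R : realType) : semi_inner (L2fun R) := L2dot_subdef R.

Section L2_norm.
Context (R : realType).
Notation mu := (@lebesgue_measure R).
Notation L2dot := (L2dot R).
Implicit Types f g : L2fun R.

Lemma L2dotE f g : L2dot f g = (\int[mu]_x (f x * g x))%R.
Proof. by rewrite L2dot.unlock. Qed.

Lemma L2dot_eq0 f g : (forall x, f x * g x = 0) -> L2dot f g = 0.
Proof.
move=> fg; rewrite L2dotE (@eq_Rintegral _ _ _ mu _ (cst 0)).
  by rewrite Rintegral_cst// mul0r.
by move=> x _; exact: fg.
Qed.

Lemma EFin_nsq f : (nsq L2dot f)%:E = (\int[mu]_x (f x ^+ 2)%:E)%E.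
Proof.
rewrite /nsq L2dotE /Rintegral fineK; last first.
  by apply: integrable_fin_num => //; exact: integrable_mul.
by apply: eq_integral => x _; rewrite expr2.
Qed.

Lemma L2normE f : L2norm f = (Num.sqrt (nsq L2dot f))%:E.
Proof.
rewrite /L2norm unlock.
transitivity ((\int[mu]_x (f x ^+ 2)%:E) `^ 2^-1)%E.
  congr (_ `^ _)%E; apply: eq_integral => x _ /=.
  by rewrite powR_mulrn// real_normK// num_real.
by rewrite -EFin_nsq poweR_EFin powR12_sqrt// nsq_ge0.
Qed.

End L2_norm.

Section L2_members.
Context (R : realType).
Notation mu := (@lebesgue_measure R).
Notation V := (L2fun R).

Definition mkL2 (f : R -> R) (fL : f \in @L2 R) : V := Lfun_Sub (le1_2e R) fL.

Lemma mkL2E f (fL : f \in @L2 R) x : mkL2 fL x = f x. Proof. by []. Qed.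

Lemma L2funP (f : V) : (f : R -> R) \in @L2 R. Proof. exact: LfunP. Qed.

Lemma mem_L2 (f : R -> R) : measurable_fun setT f ->
  (\int[mu]_x (f x ^+ 2)%:E < +oo)%E -> f \in @L2 R.
Proof.
move=> mf fi; rewrite inE; apply/andP; split; first by rewrite inE.
rewrite inE /finite_norm/= unlock; apply: poweR_lty.
rewrite (_ : (\int[mu]_x _)%E = \int[mu]_x (f x ^+ 2)%:E)%E//.
apply: eq_integral => x _ /=.
by rewrite powR_mulrn// real_normK// num_real.
Qed.

Lemma L2fun_measurable (f : V) : measurable_fun setT (f : R -> R).
Proof. exact: (@measurable_funPT _ _ _ _ f). Qed.

Lemma mem_L2_le (f : R -> R) (g : V) : measurable_fun setT f ->
  (forall x, `|f x| <= `|g x|) -> f \in @L2 R.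
Proof.
move=> mf fg; apply: mem_L2 => //.
apply: (@le_lt_trans _ _ (\int[mu]_x (g x ^+ 2)%:E)%E); last first.
  by rewrite -EFin_nsq ltry.
apply: ge0_le_integral => //.
- by move=> x _; rewrite lee_fin sqr_ge0.
- by apply/measurable_EFinP; exact: measurable_funX.
- by apply/measurable_EFinP; exact: measurable_funX.
- move=> x _; rewrite lee_fin -[f x ^+ 2]real_normK ?num_real//.
  by rewrite -[g x ^+ 2]real_normK ?num_real// ler_sqr ?nnegrE.
Qed.

Lemma integral_sqr_indic (A : set R) : measurable A ->
  (\int[mu]_x ((\1_A x : R) ^+ 2)%:E = mu A)%E.
Proof.
move=> mA; rewrite -[in RHS](setIT A) -integral_indic//.
by apply: eq_integral => x _; rewrite indicE; case: (_ \in _); rewrite ?expr1n ?expr0n.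
Qed.

Lemma mem_L2_indic (A : set R) : measurable A -> (mu A < +oo)%E ->
  (\1_A : R -> R) \in @L2 R.
Proof.
by move=> mA Afin; apply: mem_L2 => //; rewrite integral_sqr_indic.
Qed.

Lemma mem_L2_abs (f : V) : (fun x => `|f x|) \in @L2 R.
Proof.
apply: (@mem_L2_le _ f) => [|x]; last by rewrite normr_id.
exact: (measurableT_comp (@normr_measurable R setT) (L2fun_measurable f)).
Qed.

Definition absL2 (f : V) : V := mkL2 (mem_L2_abs f).

Lemma nsq_absL2 f : nsq (L2dot R) (absL2 f) = nsq (L2dot R) f.
Proof.
rewrite /nsq !L2dotE; apply: eq_Rintegral => x _.
by rewrite -normrM ger0_norm// -expr2 sqr_ge0.
Qed.

Lemma itvoc_fin (a b : R) : (mu `]a, b]%classic < +oo)%E.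
Proof. by rewrite lebesgue_measure_itv/=; case: ifP => // _; rewrite ltry. Qed.

Lemma mem_L2_itv (a b : R) : (\1_(`]a, b]%classic) : R -> R) \in @L2 R.
Proof. by apply: mem_L2_indic => //; exact: itvoc_fin. Qed.

Definition itvL2 (a b : R) : V := mkL2 (mem_L2_itv a b).

Lemma itvL2E (a b x : R) : itvL2 a b x = (a < x <= b)%R%:R.
Proof. by rewrite /itvL2 mkL2E indicE mem_setE in_itv. Qed.

Lemma nsq_itvL2 a b : a <= b -> nsq (L2dot R) (itvL2 a b) = b - a.
Proof.
move=> ab; apply: EFin_inj; rewrite EFin_nsq.
rewrite integral_sqr_indic// lebesgue_measure_itv/= lte_fin.
case: ltP => // ba; have -> : b = a by apply/le_anti; rewrite ab ba.
by rewrite subrr.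
Qed.

(** Disjoint unit intervals to the right of [R0]: the fresh region that carries the gadget of a new
    block. *)
Lemma orthonormal_itvL2 (R0 : R) (I : finType) (i j : I) :
  L2dot R (itvL2 (R0 + (enum_rank i)%:R) (R0 + (enum_rank i)%:R + 1))
          (itvL2 (R0 + (enum_rank j)%:R) (R0 + (enum_rank j)%:R + 1)) = (i == j)%:R.
Proof.
have [<-|ij] := eqVneq i j.
  by rewrite -[LHS]/(nsq _ _) nsq_itvL2 ?lerDl// addrAC subrr add0r.
rewrite L2dot_eq0 // => x; rewrite !itvL2E -natrM mulnb.
case: andP => // -[/andP[a1 a2] /andP[b1 b2]]; exfalso.
have : (enum_rank i)%:R < (enum_rank j).+1%:R :> R by rewrite -natr1; lra.
have : (enum_rank j)%:R < (enum_rank i).+1%:R :> R by rewrite -natr1; lra.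
rewrite !ltr_nat !ltnS => h1 h2; move/eqP: ij; apply; apply: enum_rank_inj.
by apply/val_inj/eqP; rewrite eqn_leq h1 h2.
Qed.

End L2_members.

(** * Construction of the sequence *)

Section construction.
Context (R : realType).
Notation V := (L2fun R).
Notation ip := (L2dot R).
Variables (theta Q T C : R).
Hypotheses (theta0 : 0 < theta) (theta1 : theta <= 1 / 4).
Hypothesis QQ : ((1 + 2 * theta) / (1 - 2 * theta)) ^+ 2 < Q.
Hypotheses (T0 : 0 < T).
Hypotheses (QT1 : 1 <= Q * (1 + T ^+ 2)) (QTC : Q * (1 + T ^+ 2) < C).

Let zs (s : seq V) := nth 0 s.

(** The invariant of the construction: D < C leaves room for further losses, and [B] marks where a
    fresh region begins. Beyond the end of the list [zs] gives 0, so the last two clauses may range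
    over all [j]. *)
Variant admissible (s : seq V) : Prop := Admissible (D B : R) of
    Q * (1 + T ^+ 2) <= D & D < C
  & basis_upto ip D (size s) (zs s)
  & (forall j, (j < size s)%N -> 0 < nsq ip (zs s j))
  & (forall j x, 0 <= zs s j x)
  & (forall j x, B < x -> zs s j x = 0).

Definition dist_span_le s (h : V) (delta : R) :=
  exists a, nsq ip (h - comb (size s) a (zs s)) <= delta.

Lemma comb_cat s t (a : nat -> R) m : (m <= size s)%N ->
  comb m a (zs (s ++ t)) = comb m a (zs s).
Proof.
move=> ms; apply: eq_combr => j jm.
by rewrite /zs nth_cat (leq_trans jm ms).
Qed.

Lemma dist_span_le_cat s t h delta : dist_span_le s h delta -> dist_span_le (s ++ t) h delta.
Proof.
move=> [a ha]; exists (fun j => if (j < size s)%N then a j else 0).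
by rewrite comb_trunc ?size_cat ?leq_addr// comb_cat.
Qed.

Lemma dist_span_leW s h delta delta' : delta <= delta' -> dist_span_le s h delta -> dist_span_le s h delta'.
Proof. by move=> dd [a ha]; exists a; exact: le_trans dd. Qed.

(** The gain in squared distance depends on [T] alone, whereas [tau] is chosen after [D], so any
    number of blocks fits below [C]. *)
Lemma extend_block s (h : V) (B : R) : admissible s -> (forall x, B < x -> h x = 0) ->
  exists t, [/\ admissible (s ++ t), (0 < size t)%N &
    forall delta, dist_span_le s h delta -> dist_span_le (s ++ t) h (delta / (1 + T ^+ 2 / 4))].
Proof.
move=> [D B' QD DC sD s0 spos sB] hB.
have D1 : 1 <= D by exact: le_trans QD.
pose n := size s.
have [a0 ha0] := orthogonal_residual ip n (zs s) h.
set phi := h - comb n a0 (zs s) in ha0.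
pose nu := Num.sqrt (nsq ip phi).
(* If [phi] has norm zero, then the inverse of [nu] is 0 and [x = 0]; the bound [nsq ip x <= 1]
   covers both cases. *)
pose x := nu^-1 *: phi.
pose B0 := Num.max B B'.
have x1 : nsq ip x <= 1.
  rewrite /x nsqZ exprVn sqr_sqrtr ?nsq_ge0//.
  by have [->|p0] := eqVneq (nsq ip phi) 0; rewrite ?mulr0// mulVf.
have xB (y : R) : B0 < y -> x y = 0.
  rewrite gt_max => /andP[By B'y].
  rewrite /x /phi L2fun_scaleE L2fun_addE L2fun_oppE L2fun_combE hB//.
  rewrite big1 ?subr0 ?mulr0//.
  by move=> j _; rewrite sB// mulr0.
(* For tau <= 1/2 one has (1 + tau) / (1 - tau) <= 1 + 4 tau, and the last bound makes 4 tau D at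
   most half of C - D. *)
pose tau0 := Num.min (1 / 2) (Num.min T ((C - D) / (8 * D))).
have tau00 : 0 < tau0.
  have D0 : 0 < D by lra.
  by rewrite !lt_min T0 !divr_gt0 ?subr_gt0 ?mulr_gt0.
have [tau /andP[tgt0 tle]] := gadget_exists theta0 theta1 QQ T0 tau00.
move: tle; rewrite !le_min => /andP[t12 /andP[tT tC]].
move=> [I N Y sg b0 r d N0 Y0 Y1 YQ abssE sE b0E r1 dt d0 dr rr].
pose e (i : I) : V := itvL2 (B0 + (enum_rank i)%:R) (B0 + (enum_rank i)%:R + 1).
have eB i (y : R) : B0 + #|I|%:R < y -> e i y = 0.
  move=> By; rewrite itvL2E; case: andP => // -[_ h1]; exfalso.
  have : (enum_rank i).+1%:R <= #|I|%:R :> R by rewrite ler_nat.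
  by rewrite -natr1; lra.
have e0 (v : V) i : (forall y : R, B0 < y -> v y = 0) -> ip (e i) v = 0.
  move=> vB; apply: L2dot_eq0 => y; rewrite itvL2E.
  case: andP => [[h1 _]|_]; last by rewrite mul0r.
  rewrite vB ?mulr0//; apply: le_lt_trans h1.
  by rewrite lerDl.
pose ax := absL2 x.
pose block (j : nat) : V := \sum_i Y j i *: e i + 2^-1 *: (`|sg j| *: ax + sg j *: x).
have blockE j (y : R) : block j y =
    \sum_i Y j i * e i y + 2^-1 * (`|sg j| * `|x y| + sg j * x y).
  by rewrite /block L2fun_addE L2fun_sumE.
pose t := mkseq block N.
have szt : size t = N by rewrite size_mkseq.
have z'z j : (j < n)%N -> zs (s ++ t) j = zs s j by move=> jn; rewrite /zs nth_cat jn.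
have z'E j : (j < N)%N -> zs (s ++ t) (n + j)%N = block j.
  by move=> jN; rewrite /zs nth_cat ltnNge leq_addr/= addKn nth_mkseq.
have xz j : (j < n)%N -> ip x (zs s j) = 0.
  by move=> jn; rewrite dotZl ha0 ?mulr0.
have ez i j : (j < n)%N -> ip (e i) (zs s j) = 0.
  move=> _; apply: e0 => y; rewrite gt_max => /andP[_]; exact: sB.
have ex i : ip (e i) x = 0 by exact: e0.
have eax i : ip (e i) ax = 0.
  by apply: e0 => y By; rewrite mkL2E xB// normr0.
have e1 (i j : I) : ip (e i) (e j) = (i == j)%:R by exact: orthonormal_itvL2.
have ax1 : nsq ip ax <= 1 by rewrite nsq_absL2.
have tau1 : tau < 1 by lra.
exists t; split.
- apply: (@Admissible _ (D * ((1 + tau) / (1 - tau))) (B0 + #|I|%:R)).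
  + apply: (le_trans QD); rewrite ler_peMr//; first by lra.
    by rewrite ler_pdivlMr; lra.
  + apply: (@le_lt_trans _ _ (D * (1 + 4 * tau))).
      apply: ler_wpM2l; first by lra.
      by rewrite ler_pdivrMr; nra.
    have := tC; rewrite ler_pdivlMr; last by lra.
    have CD : 0 < C - D by rewrite subr_gt0.
    lra.
  + rewrite size_cat szt.
    exact: (block_basis YQ abssE sE r1 dt (ltW tgt0) tau1 tT D1 QD sD e1 ez ex
      eax xz x1 ax1 z'z z'E).
  + rewrite size_cat szt => j jnN; have [jn|nj] := ltnP j n.
      by rewrite z'z//; exact: s0.
    have jE : j = (n + (j - n))%N by rewrite subnKC.
    have jN : (j - n < N)%N by rewrite ltn_subLR.
    rewrite jE.
    exact: (block_gt0 abssE sE e1 ex eax z'E jN (Y1 _ jN)).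
  + move=> j y; rewrite /zs nth_cat; case: ifP => [_|_]; first exact: spos.
    have [jN|jN] := ltnP (j - n) N; last by rewrite nth_default// size_mkseq.
    rewrite nth_mkseq// blockE addr_ge0//.
      by apply: sumr_ge0 => i _; apply: mulr_ge0; rewrite ?itvL2E ?ler0n//; exact: Y0.
    rewrite mulr_ge0// -normrM.
    by have := ler_norm (- (sg (j - n)%N * x y)); rewrite normrN; lra.
  + move=> j y By.
    have B0y : B0 < y by rewrite (le_lt_trans _ By)// lerDl.
    rewrite /zs nth_cat; case: ifP => [_|_].
      by apply: sB; move: B0y; rewrite gt_max => /andP[].
    have [jN|jN] := ltnP (j - n) N; last by rewrite nth_default// size_mkseq.
    rewrite nth_mkseq// blockE xB// normr0 !mulr0 addr0 mulr0 addr0 big1// => i _.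
    by rewrite eB// mulr0.
- by rewrite szt.
- move=> delta [a ha].
  (* By Pythagoras [phi] realises the distance from [h] to the old span. *)
  have phi_le : nsq ip phi <= delta.
    apply: le_trans ha.
    have -> : h - comb n a (zs s) = phi + (comb n a0 (zs s) - comb n a (zs s)).
      by rewrite /phi addrA subrK.
    rewrite (nsqD ip phi) dotDr dotNr !(dot_comb0 _ ha0) subrr mulr0 addr0 lerDl.
    exact: nsq_ge0.
  have T1 : 0 < 1 + T ^+ 2 / 4 by rewrite ltr_wpDr// divr_ge0// sqr_ge0.
  suff [b hb] : exists b : nat -> R,
      nsq ip (phi - comb N b (fun j => zs (s ++ t) (n + j)%N)) <=
      nsq ip phi / (1 + T ^+ 2 / 4).
    exists (fun j => if (j < n)%N then a0 j else b (j - n)%N).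
    rewrite size_cat szt comb_add comb_cat//.
    rewrite (@eq_comb _ _ n _ a0); last by move=> j ->.
    rewrite (@eq_comb _ _ N _ b); last by move=> j _; rewrite ltnNge leq_addr/= addKn.
    rewrite opprD addrA; apply: (le_trans hb).
    by rewrite ler_pM2r ?invr_gt0.
  have [nu0|nu0] := eqVneq (nsq ip phi) 0.
    exists (fun=> 0); rewrite comb0// subr0 nu0 mul0r.
    by rewrite -nu0.
  have [b hb] := block_residual abssE sE b0E r1 dr e1 ex x1 z'E nu.
  exists b; move: hb; rewrite /x scalerA divff ?scale1r; last first.
    by rewrite sqrtr_eq0 -ltNge lt_neqAle eq_sym nu0 nsq_ge0.
  by rewrite sqr_sqrtr// nsq_ge0.
Qed.

Lemma approach s (h : V) (B : R) : admissible s -> (forall x, B < x -> h x = 0) ->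
  forall delta, 0 < delta -> exists t, admissible (s ++ t) /\ dist_span_le (s ++ t) h delta.
Proof.
move=> adm hB delta delta0.
have T1 : 1 < 1 + T ^+ 2 / 4 by rewrite ltrDl divr_gt0// exprn_gt0.
have T10 := lt_trans ltr01 T1.
pose rho := (1 + T ^+ 2 / 4)^-1.
have iter n : exists t, admissible (s ++ t) /\ dist_span_le (s ++ t) h (nsq ip h * rho ^+ n).
  elim: n => [|n [t [admt neart]]].
    exists [::]; rewrite cats0; split=> //; exists (fun=> 0).
    by rewrite comb0// subr0 expr0 mulr1.
  have [t' [adm' _ near']] := extend_block admt hB.
  exists (t ++ t'); rewrite catA; split => //.
  by rewrite exprSr mulrA; exact: near'.
have /cvgrPdist_lt /(_ (delta / (nsq ip h + 1))) : rho ^+ n @[n --> \oo] --> 0.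
  by apply: cvg_expr; rewrite ger0_norm ?invr_ge0 ?(ltW T10)// invf_lt1.
have h1 : 0 < nsq ip h + 1 by rewrite ltr_wpDl// nsq_ge0.
case; first by rewrite divr_gt0.
move=> n _ /(_ n (leqnn n)) /=; rewrite sub0r normrN ger0_norm; last first.
  by rewrite exprn_ge0// invr_ge0 ltW.
rewrite ltr_pdivlMr// => small.
have [t [admt neart]] := iter n; exists t; split => //; apply: dist_span_leW neart.
apply: le_trans (ltW small); rewrite mulrDr mulr1 [leRHS]addrC mulrC lerDr.
by rewrite exprn_ge0// invr_ge0 ltW.
Qed.

Variable H : nat -> V.
Hypothesis HB : forall i, exists B : R, forall x, B < x -> H i x = 0.

Lemma approach_all s k delta : admissible s -> 0 < delta ->
  exists t, [/\ admissible (s ++ t), (0 < size t)%N &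
    forall i, (i < k)%N -> dist_span_le (s ++ t) (H i) delta].
Proof.
move=> adm delta0; elim: k => [|k [t [admt szt neart]]].
  (* The block for [h = 0] serves only to make the list longer. *)
  have [|t [admt szt _]] := @extend_block s 0 0 adm; first by [].
  by exists t.
have [B hB] := HB k.
have [t' [admt' neart']] := approach admt hB delta0.
exists (t ++ t'); rewrite catA size_cat addn_gt0 szt; split => // i.
rewrite ltnS leq_eqVlt => /predU1P[->//|ik].
by apply: dist_span_le_cat; exact: neart.
Qed.

Lemma admissible_nil : admissible [::].
Proof.
apply: (@Admissible _ (Q * (1 + T ^+ 2)) 0) => //.
- move=> a m; rewrite leqn0 => /eqP ->.
  by rewrite ler_peMl// nsq_ge0.
- by move=> j x; rewrite /zs nth_nil.
- by move=> j x _; rewrite /zs nth_nil.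
Qed.

(** Stage [k] brings the first [k] targets within 1/(k+1) in squared distance and appends at least
    one vector. The lists extend each other, so they define a sequence, and all their constants stay
    below the same [C]. *)
Lemma nonneg_basis_exists : exists z : nat -> V,
  [/\ forall n, basis_upto ip C n z, forall j, 0 < nsq ip (z j),
      forall j x, 0 <= z j x &
      forall i delta, 0 < delta ->
        exists n (a : nat -> R), nsq ip (H i - comb n a z) <= delta].
Proof.
have /choice[next nextP] : forall ks : nat * seq V, exists s', admissible ks.2 ->
    [/\ admissible s', exists2 t, s' = ks.2 ++ t & (0 < size t)%N &
      forall i, (i < ks.1)%N -> dist_span_le s' (H i) (ks.1.+1%:R)^-1].
  move=> [k s]; have [adm|nadm] := pselect (admissible s); last by exists s.
  have [|t [admt szt neart]] := @approach_all s k (k.+1%:R)^-1 adm.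
    by rewrite invr_gt0.
  by exists (s ++ t) => _; split => //; exists t.
pose S := fix S k := if k is k'.+1 then next (k', S k') else [::].
have Sadm k : admissible (S k).
  by elim: k => [|k IH]; [exact: admissible_nil|case: (nextP (k, S k) IH)].
have Scat k : exists2 t, S k.+1 = S k ++ t & (0 < size t)%N.
  by case: (nextP (k, S k) (Sadm k)).
have Sprefix k l : (k <= l)%N -> exists t, S l = S k ++ t.
  move=> kl; rewrite -(subnKC kl); elim: (l - k)%N => [|p [t IH]].
    by exists [::]; rewrite addn0 cats0.
  have [t' + _] := Scat (k + p)%N; rewrite addnS IH => ->.
  by exists (t ++ t'); rewrite catA.
have Ssize k : (k <= size (S k))%N.
  elim: k => // k IH; have [t -> t0] := Scat k.
  by rewrite size_cat -addn1 leq_add.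
pose z j : V := zs (S j.+1) j.
have zE k j : (j < size (S k))%N -> z j = zs (S k) j.
  move=> jk; rewrite /z.
  have [/Sprefix[t ->]|/ltnW/Sprefix[t ->]] := leqP j.+1 k.
    by rewrite /zs nth_cat Ssize.
  by rewrite /zs nth_cat jk.
have combE k m a : (m <= size (S k))%N -> comb m a z = comb m a (zs (S k)).
  by move=> mk; apply: eq_combr => j jm; apply: zE; exact: leq_trans mk.
exists z; split.
- move=> n a m mn; have nS := Ssize n.
  rewrite (combE n m) ?(leq_trans mn)// (combE n n)//.
  have [D B _ DC Sbasis _ _ _] := Sadm n.
  (* Zeroing the coefficients from [n] on turns the inequality for the whole list into the one for
     length [n]. *)
  have := Sbasis (fun j => if (j < n)%N then a j else 0) m (leq_trans mn nS).
  rewrite (comb_trunc a (zs (S n)) nS).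
  rewrite (@eq_comb _ _ m _ a); last by move=> j jm; rewrite (leq_trans jm mn).
  by move=> /le_trans; apply; rewrite ler_wpM2r ?nsq_ge0// ltW.
- by move=> j; have [D B _ _ _ + _ _] := Sadm j.+1; apply; exact: Ssize.
- by move=> j x; have [D B _ _ _ _ + _] := Sadm j.+1; apply.
- move=> i delta delta0; pose k := (i + (Num.bound delta^-1)).+1.
  have [_ _ /(_ i)[]] := nextP (k, S k) (Sadm k).
    by rewrite /= ltnS leq_addr.
  move=> a ha; exists (size (S k.+1)), a.
  rewrite (combE k.+1)//; apply: (le_trans ha) => /=.
  rewrite -[leRHS]invrK lef_pV2 ?posrE ?invr_gt0//.
  apply: (le_trans (ltW (archi_boundP _))); first by rewrite invr_ge0 ltW.
  by rewrite ler_nat /k ltnW// ltnW// !ltnS leq_addl.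
Qed.

End construction.

(** * Density of step functions *)

Section density.
Context (R : realType).
Notation V := (L2fun R).
Notation mu := (@lebesgue_measure R).
Notation ip := (L2dot R).

Lemma L2_dominated (f F : V) (g : nat -> V) :
  (forall n x, `|f x - g n x| <= `|F x|) ->
  (forall x, (g n x : R) @[n --> \oo] --> (f x : R)) ->
  forall delta, 0 < delta -> exists n, nsq ip (f - g n) <= delta.
Proof.
move=> fF gf delta delta0.
pose f_ n (x : R) : \bar R := ((f x - g n x) ^+ 2)%:E.
have [|||||_ _] := @dominated_convergence _ _ _ mu setT measurableT f_ (cst 0%E)
    (fun x => (F x ^+ 2)%:E).
- move=> n; apply/measurable_EFinP; apply: measurable_funX.
  exact: (L2fun_measurable (f - g n)).
- exact: measurable_cst.
- apply/aeW => x _; apply: cvg_EFin; first exact: nearW.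
  have d0 : (f x - g n x : R) @[n --> \oo] --> (0 : R).
    by rewrite -(subrr (f x : R)); exact: (cvgB (cvg_cst (f x : R)) (gf x)).
  have h := cvgM d0 d0; rewrite mulr0 in h.
  exact: h.
- exact: (integrable_mul F F).
- apply/aeW => x n _ /=; rewrite lee_fin ger0_norm ?sqr_ge0//.
  rewrite -[leLHS]real_normK ?num_real// -[leRHS]real_normK ?num_real//.
  by rewrite ler_sqr ?nnegrE.
rewrite integral0 => /fine_cvg /cvgrPdist_lt /(_ _ delta0)[n _ /(_ n (leqnn n))] h0.
have h : `|0 - fine (\int[mu]_x f_ n x)%E| < delta := h0.
have hE : fine (\int[mu]_x f_ n x)%E = nsq ip (f - g n).
  by rewrite -[RHS]/(fine (_%:E)) EFin_nsq.
exists n; move: h; rewrite hE sub0r normrN => h.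
exact: le_trans (ler_norm _) (ltW h).
Qed.

(** [P] stands for membership in a closed linear subspace containing the indicators of rational
    intervals; it is later instantiated with approximability by the span. *)
Variable P : V -> Prop.
Hypothesis PD : forall f g, P f -> P g -> P (f + g).
Hypothesis PZ : forall (a : R) f, P f -> P (a *: f).
Hypothesis Plim : forall f,
  (forall delta, 0 < delta -> exists2 g, P g & nsq ip (f - g) <= delta) -> P f.
Hypothesis Prat : forall p q : rat, P (itvL2 (ratr p) (ratr q)).

Let P0 : P 0.
Proof. by rewrite -(scale0r (itvL2 (ratr 0) (ratr 0))); exact: PZ. Qed.

Let PB f g : P f -> P g -> P (f - g).
Proof. by move=> Pf Pg; rewrite -[- g]scaleN1r; apply: PD => //; exact: PZ. Qed.

Let Psum (I : Type) (r : seq I) (F : I -> V) :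
  (forall i, P (F i)) -> P (\sum_(i <- r) F i).
Proof. by move=> PF; apply: (big_ind P) => // f g; exact: PD. Qed.

Let Pitv a b : P (itvL2 a b).
Proof.
have [ab|ba] := ltP a b; last first.
  rewrite (_ : itvL2 a b = 0)//; apply/LfuneqP => x.
  rewrite itvL2E L2fun_0E; case: andP => // -[ax xb].
  by have := lt_le_trans ax (le_trans xb ba); rewrite ltxx.
apply: Plim => delta delta0.
(* Both ends move to the right, with a < p < b < q, so the difference of indicators is that of (a,
   p] minus that of (b, q]. *)
have d4 : 0 < delta / 4 by rewrite divr_gt0.
have ap0 : a < Num.min b (a + delta / 4) by rewrite lt_min ab ltrDl.
have bq0 : b < b + delta / 4 by rewrite ltrDl.
have [p] := rat_in_itvoo ap0; have [q] := rat_in_itvoo bq0.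
rewrite !in_itv/= => /andP[bq qb] /andP[ap]; rewrite lt_min => /andP[pb pa].
exists (itvL2 (ratr p) (ratr q)) => //.
have -> : itvL2 a b - itvL2 (ratr p) (ratr q) =
    itvL2 a (ratr p) - itvL2 b (ratr q).
  apply/LfuneqP => x; rewrite !L2fun_addE !L2fun_oppE !itvL2E.
  by case: (ltP a x) => ?; case: (ltP (ratr p) x) => ?; case: (leP x b) => ?;
    case: (leP x (ratr q)) => ? //=; lra.
apply: (le_trans (nsqD_le2 _ _ _)).
rewrite nsqN !nsq_itvL2 ?(ltW ap) ?(ltW bq)//; lra.
Qed.

Section bounded_window.
Variable n : nat.
Let J : set R := `]- n%:R, n%:R]%classic.

(* Quantifying over all [g] avoids carrying a proof that the indicator is in
   [L_2]. *)
Definition window (A : set R) := forall g : V, (forall x, g x = \1_(A `&` J) x) -> P g.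

Lemma windowL2 (A : set R) : measurable A -> (\1_(A `&` J) : R -> R) \in @L2 R.
Proof.
move=> mA; have mJ : measurable J by exact: measurable_itv.
have mAJ : measurable (A `&` J) by apply: measurableI.
apply: mem_L2_indic => //.
apply: (@le_lt_trans _ _ (mu J)); last exact: itvoc_fin.
by apply: le_measure; rewrite ?inE// => x [].
Qed.

Let itvJ : V := itvL2 (- n%:R) n%:R.

Let itvJE x : itvJ x = \1_J x. Proof. by rewrite /itvJ /itvL2 mkL2E. Qed.

(** Dynkin's argument: half-open intervals are stable under intersection and generate the measurable
    sets. Cutting with [J] keeps every indicator below that of [J], which dominates in the case of
    disjoint unions. *)
Lemma window_measurable (A : set R) : measurable A -> window A.
Proof.
move=> mA.
apply: (@dynkin_induction _ _ (@ocitv R) window) => //.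
- exact: ocitvI.
- move=> g gE; rewrite (_ : g = itvJ); first exact: Pitv.
  by apply/LfuneqP => x; rewrite gE setTI itvJE.
- move=> _ [[a b] _ <-] g gE.
  rewrite (_ : g = itvL2 (Num.max a (- n%:R)) (Num.min b n%:R)); first exact: Pitv.
  apply/LfuneqP => x; rewrite gE itvL2E indicE in_setI !mem_setE !in_itv/=.
  by rewrite gt_max le_min andbACA.
- move=> S mS PS g gE.
  rewrite (_ : g = itvJ - mkL2 (windowL2 mS)).
    by apply: PB; [exact: Pitv|exact: PS].
  apply/LfuneqP => x; rewrite gE L2fun_addE L2fun_oppE itvJE mkL2E !indicE.
  rewrite !in_setI in_setC; do 2 case: (_ \in _) => //=; rewrite ?subr0 ?subrr//.
- move=> F mF tF PF g gE.
  pose h m : V := \sum_(0 <= k < m) mkL2 (windowL2 (mF k)).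
  have hE m x : h m x = \sum_(0 <= k < m) \1_(F k `&` J) x.
    by rewrite /h L2fun_sumE.
  have hin m x k : (F k `&` J) x -> h m x = (k < m)%N%:R.
    move=> Fkx; rewrite hE big_mkord.
    have other l : l != k -> \1_(F l `&` J) x = 0 :> R.
      move=> lk; rewrite indicE memNset// => -[Flx _].
      move/eqP: lk; apply; apply: tF => //; exists x; split => //.
      by case: Fkx.
    have [km|mk] := ltnP k m.
      rewrite (bigD1 (Ordinal km))//= big1 ?addr0; last first.
        by move=> l lk; apply: other.
      by rewrite indicE mem_set.
    rewrite big1// => l _; apply: other; rewrite neq_ltn.
    by rewrite (leq_trans (ltn_ord l)).
  have hout m x : ~ ((\bigcup_k F k) `&` J) x -> h m x = 0.
    move=> nx; rewrite hE big1// => k _; rewrite indicE memNset// => -[Fkx Jx].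
    by apply: nx; split => //; exists k.
  apply: Plim => delta delta0.
  have [||m hm] := @L2_dominated g itvJ h _ _ _ delta0; last first.
  + by exists (h m) => //; apply: Psum => k; exact: PF.
  + move=> x; rewrite gE.
    have [[[k _ Fkx] Jx]|nx] := pselect (((\bigcup_k F k) `&` J) x).
      apply: cvg_near_cst; exists k.+1 => // m /= km.
      rewrite (hin m x k)// km indicE mem_set//; split => //; exists k => //.
    rewrite indicE memNset//; apply: cvg_near_cst; apply: nearW => m.
    exact: hout.
  + move=> m x; rewrite gE itvJE.
    have [[[k _ Fkx] Jx]|nx] := pselect (((\bigcup_k F k) `&` J) x).
      rewrite (hin m x k)// !indicE mem_set; last by split => //; exists k.
      rewrite mem_set// normr1; case: (k < m)%N => /=; rewrite ?subrr ?normr0//.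
      by rewrite subr0 normr1.
    by rewrite hout// indicE memNset// subrr normr0.
Qed.

End bounded_window.

(** Simple functions increasing to [f], cut to growing windows, converge pointwise and are dominated
    by [f]; each is a finite combination of windowed level sets. *)
Let Pnneg (f : V) : (forall x, 0 <= f x) -> P f.
Proof.
move=> f0; apply: Plim => delta delta0.
have mf : measurable_fun setT (EFin \o f).
  by apply/measurable_EFinP; exact: L2fun_measurable.
pose g n := nnsfun_approx measurableT mf n.
have g0 n x : 0 <= g n x by exact: fun_ge0.
have gf n x : g n x <= f x.
  rewrite -lee_fin /g nnsfun_approxE; apply: le_approx => // y _.
  by rewrite lee_fin.
pose J n : set R := `]- n%:R, n%:R]%classic.
pose h0 n (x : R) : R := g n x * \1_(J n) x.
have h0f n x : 0 <= h0 n x <= f x.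
  rewrite /h0 indicE; case: (_ \in _); rewrite ?mulr1 ?mulr0 ?g0 ?gf//.
  by rewrite lexx f0.
have mh0 n : measurable_fun setT (h0 n).
  have mJ : measurable (J n) by exact: measurable_itv.
  apply: measurable_funM; last exact: measurable_indic.
  exact: (@measurable_funPT _ _ _ _ (g n)).
have h0L2 n : h0 n \in @L2 R.
  apply: (@mem_L2_le _ _ f) => // x; have /andP[h1 h2] := h0f n x.
  by rewrite !ger0_norm.
have [||n hn] := @L2_dominated f f (fun n => mkL2 (h0L2 n)) _ _ _ delta0; last first.
- exists (mkL2 (h0L2 n)) => //.
  pose s : seq R := finmap.enum_fset (fset_set (g n @` setT)).
  have mA i : measurable (g n @^-1` [set s`_i]) by [].
  rewrite (_ : mkL2 _ = \sum_(i < size s) s`_i *: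
      mkL2 (@windowL2 n _ (mA i))).
    by apply: Psum => i; apply: PZ; exact: (@window_measurable n _ (mA i)).
  apply/LfuneqP => x; rewrite L2fun_sumE mkL2E /h0 fimfunEord mulr_suml.
  apply: eq_bigr => i _; rewrite L2fun_scaleE mkL2E -mulrA; congr (_ * _).
  by rewrite indicI.
- move=> x; have gx : (g n x : R) @[n --> \oo] --> (f x : R).
    apply: (@fine_cvg _ _ _ _ (EFin \o g^~ x)).
    by apply: cvg_nnsfun_approx => // y _; rewrite lee_fin.
  apply: cvg_trans gx; apply: near_eq_cvg.
  exists (Num.bound `|x : R|) => // n /= xn; rewrite /h0 indicE mem_set ?mulr1//.
  have := lt_le_trans (archi_boundP (normr_ge0 (x : R))) (_ : _ <= n%:R).
  rewrite ler_nat => /(_ xn); rewrite ltr_norml => /andP[x1 x2].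
  by rewrite /J /= in_itv/= x1 ltW.
- move=> n x; have /andP[h1 h2] := h0f n x.
  by rewrite mkL2E ger0_norm ?subr_ge0// ger0_norm// gerBl.
Qed.

Theorem L2_density f : P f.
Proof.
have -> : f = 2^-1 *: (absL2 f + f) - 2^-1 *: (absL2 f - f).
  apply/LfuneqP => x.
  by rewrite L2fun_addE L2fun_oppE !L2fun_scaleE !L2fun_addE L2fun_oppE; lra.
apply: PB; apply: PZ; apply: Pnneg => x; rewrite L2fun_addE ?L2fun_oppE mkL2E.
  by rewrite -lerBlDr sub0r -normrN ler_norm.
by rewrite subr_ge0 ler_norm.
Qed.

End density.

(** * Rational targets, translation of the definitions, and conclusion *)

Section assembly.
Context (R : realType).
Notation V := (L2fun R).
Notation ip := (L2dot R).

Definition rat_itvL2 (i : nat) : V :=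
  if unpickle i is Some (p, q) then itvL2 (ratr p) (ratr (q : rat)) else 0.

Lemma rat_itvL2_bounded i : exists B : R, forall x, B < x -> rat_itvL2 i x = 0.
Proof.
rewrite /rat_itvL2; case: unpickle => [[p q]|]; last by exists 0.
exists (ratr q) => x qx; rewrite itvL2E [x <= _]leNgt qx andbF.
by [].
Qed.

Lemma psumE a (z : nat -> V) n :
  psum a (fun j => z j : R -> R) n = (comb n a z : R -> R).
Proof. by apply/funext => x; rewrite L2fun_combE. Qed.

Lemma expandsP (z : nat -> V) a (f : V) :
  expands ip z a f <-> expands_to (fun j => z j : R -> R) a f.
Proof.
have normE n : L2norm (fun x => f x - psum a (fun j => z j : R -> R) n x) =
    (Num.sqrt (nsq ip (f - comb n a z)))%:E.
  by rewrite -L2normE psumE.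
rewrite /expands_to; under eq_fun do rewrite normE.
split=> [fa|fa delta delta0].
- apply: cvg_EFin; first exact: nearW.
  apply/cvgrPdist_le => delta delta0.
  have [n0 h] := fa _ (exprn_gt0 2 delta0); exists n0 => // n /h hn /=.
  rewrite sub0r normrN ger0_norm ?sqrtr_ge0//.
  by rewrite -(ger0_norm (ltW delta0)) -sqrtr_sqr ler_wsqrtr.
- have /fine_cvg/cvgrPdist_le /(_ (Num.sqrt delta)) := fa.
  rewrite sqrtr_gt0 => /(_ delta0)[n0 _ h]; exists n0 => n /h /=.
  by rewrite sub0r normrN ger0_norm ?sqrtr_ge0// ler_sqrt// ltW.
Qed.

End assembly.

Theorem theorem2p2 (R : realType) (eps : R) (heps : 0 < eps) :
  exists z : nat -> R -> R,
    schauder_basis_L2 z /\ (forall j, nonneg_fun (z j)) /\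
    (basis_constant z <= (1 + eps)%:E)%E.
Proof.
pose theta := Num.min (1 / 4) (eps / 20).
have t0 : 0 < theta by rewrite lt_min !divr_gt0.
have t1 : theta <= 1 / 4 by rewrite ge_min lexx.
have t2 : theta <= eps / 20 by rewrite ge_min lexx orbT.
move: theta t0 t1 t2 => theta t0 t1 t2.
(* For theta <= 1/4 the ratio (1 + 2 theta) / (1 - 2 theta) is below 1 + 9 theta. *)
pose Q := (1 + 9 * theta) ^+ 2.
have QQ : ((1 + 2 * theta) / (1 - 2 * theta)) ^+ 2 < Q.
  rewrite ltr_sqr ?nnegrE ?divr_ge0; [|lra|lra|lra|lra].
  by rewrite ltr_pdivrMr; nra.
have QT1 : 1 <= Q * (1 + theta ^+ 2) by rewrite /Q; nra.
have QTC : Q * (1 + theta ^+ 2) < (1 + eps) ^+ 2.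
  apply: (@lt_le_trans _ _ ((1 + 20 * theta) ^+ 2)).
    apply: (@le_lt_trans _ _ (((1 + 9 * theta) * (1 + theta)) ^+ 2)).
      by rewrite exprMn /Q ler_pM2l ?exprn_gt0; nra.
    by rewrite ltr_sqr ?nnegrE; nra.
  by rewrite ler_sqr ?nnegrE; lra.
(* Here T = theta and C = (1 + eps)^2, the square of the wanted constant. *)
have [z [zC z0 zpos zH]] := nonneg_basis_exists t0 t1 QQ t0 QT1 QTC
  (@rat_itvL2_bounded R).
(* Being approximable by the span is a closed linear condition that holds for the rational
   intervals, hence for all of L_2. *)
have dense (f : L2fun R) delta : 0 < delta -> exists n (a : nat -> R),
    nsq (L2dot R) (f - comb n a z) <= delta.
  move: delta; apply: (L2_density (P := fun f => forall delta, 0 < delta ->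
    exists n (a : nat -> R), nsq (L2dot R) (f - comb n a z) <= delta)).
  - move=> {}f g Pf Pg delta delta0.
    have d4 : 0 < delta / 4 by rewrite divr_gt0.
    have [n [a ha]] := Pf _ d4; have [m [b hb]] := Pg _ d4.
    exists (maxn n m), (fun j => (if (j < n)%N then a j else 0) +
                                 (if (j < m)%N then b j else 0)).
    rewrite combD !comb_trunc ?leq_maxl ?leq_maxr// opprD addrACA.
    by apply: (le_trans (nsqD_le2 _ _ _)); lra.
  - move=> c {}f Pf delta delta0.
    have c0 : 0 < c ^+ 2 + 1 by rewrite ltr_wpDl// sqr_ge0.
    have [|n [a ha]] := Pf (delta / (c ^+ 2 + 1)); first by rewrite divr_gt0.
    exists n, (fun j => c * a j); rewrite combZ -scalerBr nsqZ.
    move: ha; rewrite ler_pdivlMr// => ha.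
    by have := nsq_ge0 (L2dot R) (f - comb n a z); lra.
  - move=> {}f Pf delta delta0.
    have d4 : 0 < delta / 4 by rewrite divr_gt0.
    have [g Pg fg] := Pf _ d4; have [n [a ha]] := Pg _ d4.
    exists n, a; apply: (le_trans (nsq_dist_le2 _ _ g _)); lra.
  - move=> p q delta delta0; have [n [a ha]] := zH (pickle (p, q)) delta delta0.
    by exists n, a; move: ha; rewrite /rat_itvL2 pickleK.
exists (fun j => z j : R -> R); split; [split|split].
- by move=> j; exact: L2funP.
- move=> f fL.
  have [a fa] := expands_exists zC z0 dense (mkL2 fL).
  exists a; split; first by have /expandsP := fa.
  move=> a' /(@expandsP R z a' (mkL2 fL)) fa'.
  exact: (expands_unique zC z0 fa fa').
- by move=> j; apply/aeW => x; exact: zpos.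
- apply: ereal_inf_lbound; exists (1 + eps) => // m n a mn.
  rewrite !psumE !L2normE -EFinM lee_fin.
  have e0 : 0 <= 1 + eps by lra.
  rewrite -[1 + eps]ger0_norm// -sqrtr_sqr -sqrtrM ?sqr_ge0//.
  by rewrite ler_wsqrtr//; exact: zC.
Qed.
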